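(* Let $p\in[1,\infty)$ and $\phi\in(1-\frac1p,1]$. Let $I,\widetilde I\in\mathfrak I^{p}_\phi(V)$. Then $$\mathbb 1^{I}\boxplus\mathbb 1^{\widetilde I}=\mathbb 1^{I+\widetilde I}.$$
   Context: Setting. $J=[S,T]$ is a fixed compact interval and $\triangle_J=\{(s,t)\in J^2: s\le t\}$. $V$ is a Banach space; $V^{\otimes n}$ ($V^{\otimes 0}=\mathbb R$) denotes its completed tensor powers with admissible norms: permutations in $S_n$ act by isometries on $V^{\otimes n}$, and $\|v\otimes w\|\le\|v\|\|w\|$. $T^{(k)}(V)=\bigoplus_{i=0}^kV^{\otimes i}$ with product $(a\otimes b)^i=\sum_{j=0}^i a^j\otimes b^{i-j}$; $a^i$ is the level-$i$ component. A control on $J$ is a continuous $\omega:\triangle_J\to[0,\infty)$ with $\omega(t,t)=0$ and $\omega(s,u)+\omega(u,t)\le\omega(s,t)$ for $s\le u\le t$. Put $x!:=\Gamma(x+1)$, $\beta(p)=p\bigl(1+\sum_{r=3}^\infty(\frac{2}{r-2})^{(\lfloor p\rfloor+1)/p}\bigr)$. A map $X:\triangle_J\to T^{(k)}(V)$ has finite $p$-variation controlled by $\omega$ with constant $K$ if $\|X^i_{s,t}\|\le K\,\omega(s,t)^{i/p}/(\beta(p)(i/p)!)$ for $i=1,\dots,k$, $(s,t)\in\triangle_J$. A multiplicative functional of degree $k$ is a continuous $X:\triangle_J\to T^{(k)}(V)$ with $X^0\equiv1$ and $X_{s,u}\otimes X_{u,t}=X_{s,t}$ for $s\le u\le t$.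 $\Omega^{(k,p)}_\omega(V)$: those of finite $p$-variation controlled by $\omega$ with some constant; $\Omega^{(k,p)}(V)$: union over all controls; $\Omega^p(V):=\Omega^{(\lfloor p\rfloor,p)}(V)$ ($p$-rough paths). Sewing. For $\theta>1$, $\Omega^{\mathrm{am},(k,p)}_{\theta,\omega}(V)$ is the set of maps $X=(1,X^1,\dots,X^k):\triangle_J\to T^{(k)}(V)$ that for some $K\ge0$ have finite $p$-variation controlled by $\omega$ with constant $K$ and satisfy $\|(X_{s,u}\otimes X_{u,t}-X_{s,t})^i\|\le K\omega(s,t)^\theta$ for $s\le u\le t$, $i=1,\dots,k$. By Lyons' rough sewing lemma, for such $X$ there is a unique multiplicative functional $\bar X$ of degree $k$ with finite $p$-variation such that $\|\bar X^i_{s,t}-X^i_{s,t}\|\le C\omega(s,t)^\theta$ for some $C$ and all $(s,t)$, $i=1,\dots,k$; it is independent of the witnessing $(p,\theta,\omega)$ and denoted $\mathscr S^k(X)$. $\mathscr H^p(V)$. It is the set of $H\in\Omega^p(V)$ for which there are a control $\omega$, $\phi\in(1-\frac1p,1]$ and $K\ge0$ with $\|H^j_{s,t}\|\le K\omega(s,t)^\phi$ for $j=1,\dots,\lfloor p\rfloor$, $(s,t)\in\triangle_J$. Operation $\boxplus$. For $X\in\Omega^p(V)$, $H\in\mathscr H^p(V)$ let $(X\oplus H)_{s,t}:=(1,X^1_{s,t}+H^1_{s,t},\dots,X^{\lfloor p\rfloor}_{s,t}+H^{\lfloor p\rfloor}_{s,t})$; this lies in some $\Omega^{\mathrm{am},(\lfloor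 p\rfloor,p)}_{\theta,\omega}(V)$, and $X\boxplus H:=\mathscr S^{\lfloor p\rfloor}(X\oplus H)\in\Omega^p(V)$. $\mathfrak I^p_\phi(V)$. It is the set of additive maps $I=(0,I^1,\dots,I^{\lfloor p\rfloor}):\triangle_J\to T^{(\lfloor p\rfloor)}(V)$ ($I_{s,u}+I_{u,t}=I_{s,t}$ for $s\le u\le t$) for which there are a control $\omega$ and $K\ge0$ with $\|I^j_{s,t}\|\le K\omega(s,t)^\phi$ for $j=1,\dots,\lfloor p\rfloor$ and $\|I^{\lfloor p\rfloor}_{s,t}\|\le K\omega(s,t)^{\lfloor p\rfloor/p}$ for all $(s,t)\in\triangle_J$. It is closed under pointwise addition. Lift map. If $Z$ is a multiplicative functional of degree $j$ with finite $q$-variation for some $q\in[1,j+1)$, $\operatorname{Ext}_j(Z)$ is the unique multiplicative functional of degree $j+1$ agreeing with $Z$ in levels $\le j$ and of finite $q$-variation (Lyons' extension theorem; independent of such $q$). For $I\in\mathfrak I^p_\phi(V)$ define recursively $\mathbb 1^{(0,I^1)}:=(1,I^1)$ and $\mathbb 1^{(0,I^1,\dots,I^m)}:=\operatorname{Ext}_{m-1}(\mathbb 1^{(0,I^1,\dots,I^{m-1})})+(0,\dots,0,I^m)$ for $2\le m\le\lfloor p\rfloor$; $\mathbb 1^I$ is the result for $m=\lfloor p\rfloor$. One has $\mathbb 1^I\in\mathscr H^p(V)$ (at stage $m<\lfloor p\rfloor$ the functional has finite $(m/\phi)$-variation with $m/\phi<m+1$). *)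

(* Defs.v *)
From HB Require Import structures.
From mathcomp Require Import all_boot all_order all_algebra perm.
From mathcomp Require Import all_classical all_reals all_analysis.

Set Implicit Arguments.
Unset Strict Implicit.
Unset Printing Implicit Defensive.

Import Order.TTheory GRing.Theory Num.Theory.
Import numFieldNormedType.Exports.

Local Open Scope classical_set_scope.
Local Open Scope ring_scope.

(** * Completed tensor powers with admissible norms *)

(* V^{(x)0} = R and V^{(x)1} = V hold by conversion; [W n] is V^{(x)(n+2)}. *)
Definition tpow_of (R : realType) (V : completeNormedModType R)
    (W : nat -> completeNormedModType R) (n : nat) : completeNormedModType R :=
  match n with
  | 0 => R^o
  | 1 => V
  | m.+2 => W m
  end.

Definition multilinear_map (R : realType) (V W : lmodType R) (n : nat)
    (f : ('I_n -> V) -> W) : Prop :=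
  forall (v : 'I_n -> V) (i : 'I_n) (a : R) (x y : V),
    f [eta v with i |-> a *: x + y] =
    a *: f [eta v with i |-> x] + f [eta v with i |-> y].

(* [pure_tensor_of tens v] is v_0 (x) ... (x) v_{n-1}. *)
Fixpoint pure_tensor_of (R : realType) (V : completeNormedModType R)
    (W : nat -> completeNormedModType R)
    (tens : forall m n, tpow_of V W m -> tpow_of V W n -> tpow_of V W (m + n))
    (n : nat) : ('I_n -> V) -> tpow_of V W n :=
  match n with
  | 0 => fun _ => (1 : R^o)
  | m.+1 => fun v =>
      tens 1 m (v ord0) (pure_tensor_of tens (fun i : 'I_m => v (lift ord0 i)))
  end.

(* V^{(x)n} is a Banach space containing the algebraic n-th tensor power of V
   as a dense subspace: [ta_inj] says that a linear combination of elementary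
   tensors vanishes in V^{(x)n} only if it vanishes in the algebraic tensor
   power, i.e. only if every multilinear map kills it. *)
Record tensor_algebra (R : realType) (V : completeNormedModType R) := {
  ta_space : nat -> completeNormedModType R;
  ta_mul : forall m n,
    tpow_of V ta_space m -> tpow_of V ta_space n -> tpow_of V ta_space (m + n);
  ta_mul_linearl : forall m n (y : tpow_of V ta_space n),
    linear (fun x : tpow_of V ta_space m => ta_mul x y);
  ta_mul_linearr : forall m n (x : tpow_of V ta_space m),
    linear (fun y : tpow_of V ta_space n => ta_mul x y);
  ta_mul0l : forall n (a : tpow_of V ta_space 0) (x : tpow_of V ta_space n),
    ta_mul a x = (a : R) *: x;
  ta_mul0r : forall n (x : tpow_of V ta_space n) (a : tpow_of V ta_space 0),
    ecast k (tpow_of V ta_space k) (addn0 n) (ta_mul x a) = (a : R) *: x;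
  ta_mulA : forall m n l (x : tpow_of V ta_space m) (y : tpow_of V ta_space n)
      (z : tpow_of V ta_space l),
    ecast k (tpow_of V ta_space k) (addnA m n l) (ta_mul x (ta_mul y z)) =
    ta_mul (ta_mul x y) z;
  ta_inj : forall n (r : seq (R * ('I_n -> V))),
    \sum_(c <- r) c.1 *: pure_tensor_of ta_mul c.2 = 0 ->
    forall (U : lmodType R) (f : ('I_n -> V) -> U), multilinear_map f ->
      \sum_(c <- r) c.1 *: f c.2 = 0;
  ta_dense : forall n,
    closure [set x : tpow_of V ta_space n |
      exists r : seq (R * ('I_n -> V)),
        x = \sum_(c <- r) c.1 *: pure_tensor_of ta_mul c.2] = setT;
  ta_norm_mul : forall m n (x : tpow_of V ta_space m) (y : tpow_of V ta_space n),
    `|ta_mul x y| <= `|x| * `|y|;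
  ta_perm : forall n (s : 'S_n),
    exists P : {linear tpow_of V ta_space n -> tpow_of V ta_space n},
      (forall v : 'I_n -> V,
         P (pure_tensor_of ta_mul v) = pure_tensor_of ta_mul (v \o s)) /\
      (forall x, `|P x| = `|x|)
}.

Section RoughPaths.
Variables (R : realType) (V : completeNormedModType R) (A : tensor_algebra V).

Definition tpow (n : nat) : completeNormedModType R := tpow_of V (ta_space A) n.

Definition tmul (m n : nat) (x : tpow m) (y : tpow n) : tpow (m + n) :=
  ta_mul x y.

(** * The truncated tensor algebra T^(k)(V) *)

Definition ttens (k : nat) := prod_topology (fun i : 'I_k.+1 => tpow i).

(* The level-i component; by convention 0 for i > k. *)
Definition lvl (k : nat) (a : ttens k) (i : nat) : tpow i :=
  match @idP (i < k.+1)%N with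
  | ReflectT lt_ik => a (Ordinal lt_ik)
  | ReflectF _ => 0
  end.

Definition mk_ttens (k : nat) (f : forall i, tpow i) : ttens k :=
  fun i : 'I_k.+1 => f i.
Arguments mk_ttens : clear implicits.

Lemma lvl_mk_ttens (k i : nat) (f : forall j, tpow j) :
  (i <= k)%N -> lvl (mk_ttens k f) i = f i.
Proof. by rewrite -ltnS /lvl; case: {-}_ / idP. Qed.

Definition ttens_mul (k : nat) (a b : ttens k) : ttens k :=
  mk_ttens k (fun i => \sum_(j < i.+1)
    ecast n (tpow n) (subnKC (leq_ord j)) (tmul (lvl a j) (lvl b (i - j)))).

Definition ttens_add (k : nat) (a b : ttens k) : ttens k :=
  mk_ttens k (fun i => lvl a i + lvl b i).

Variables (S T : R).

Definition simplex : set (R * R) :=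
  [set st | [/\ S <= st.1, st.1 <= st.2 & st.2 <= T]].

(* Maps on the simplex are represented by functions [R -> R -> _]; all the
   notions below depend on their values on the simplex only. *)
Definition two_param (k : nat) := R -> R -> ttens k.

Definition control (omega : R -> R -> R) : Prop :=
  [/\ {within simplex, continuous (fun st : R * R => omega st.1 st.2)},
      forall s t, simplex (s, t) -> 0 <= omega s t,
      forall t, simplex (t, t) -> omega t t = 0 &
      forall s u t, S <= s -> s <= u -> u <= t -> t <= T ->
        omega s u + omega u t <= omega s t].

Definition Gamma (x : R) : R :=
  \int[@lebesgue_measure R]_(t in `]0%R, +oo[) (t `^ (x - 1) * expR (- t)).

Definition rfact (x : R) : R := Gamma (x + 1).

Definition beta_cst (p : R) : R :=
  p * (1 + limn (fun n => \sum_(3 <= r < n)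
    (2 / (r - 2)%N%:R) `^ ((Num.truncn p).+1%:R / p))).

Definition pvar_controlled (k : nat) (p : R) (omega : R -> R -> R) (K : R)
    (X : two_param k) : Prop :=
  forall i, (1 <= i <= k)%N -> forall s t, simplex (s, t) ->
    `|lvl (X s t) i| <=
      K * omega s t `^ (i%:R / p) / (beta_cst p * rfact (i%:R / p)).

Definition multiplicative_functional (k : nat) (X : two_param k) : Prop :=
  [/\ {within simplex, continuous (fun st : R * R => X st.1 st.2)},
      forall s t, simplex (s, t) -> lvl (X s t) 0 = (1 : R^o) &
      forall s u t, S <= s -> s <= u -> u <= t -> t <= T ->
        ttens_mul (X s u) (X u t) = X s t].

Definition Omega_controlled (k : nat) (p : R) (omega : R -> R -> R)
    : set (two_param k) :=
  [set X | multiplicative_functional X /\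
           exists K, pvar_controlled p omega K X].

Definition Omega (k : nat) (p : R) : set (two_param k) :=
  [set X | exists omega, control omega /\ Omega_controlled p omega X].
Arguments Omega : clear implicits.

Definition rough_path (p : R) : set (two_param (Num.truncn p)) :=
  Omega (Num.truncn p) p.
Arguments rough_path : clear implicits.

(** * Sewing of almost multiplicative functionals *)

Definition Omega_am (k : nat) (p theta : R) (omega : R -> R -> R)
    : set (two_param k) :=
  [set X | (forall s t, simplex (s, t) -> lvl (X s t) 0 = (1 : R^o)) /\
    exists K, [/\ 0 <= K, pvar_controlled p omega K X &
      forall i, (1 <= i <= k)%N ->
      forall s u t, S <= s -> s <= u -> u <= t -> t <= T ->
        `|lvl (ttens_mul (X s u) (X u t)) i - lvl (X s t) i| <=
          K * omega s t `^ theta]].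

Definition is_sewing (k : nat) (X Xbar : two_param k) : Prop :=
  exists p theta omega,
    [/\ 1 <= p, 1 < theta, control omega & Omega_am p theta omega X] /\
    Omega k p Xbar /\
    exists C, forall i, (1 <= i <= k)%N -> forall s t, simplex (s, t) ->
      `|lvl (Xbar s t) i - lvl (X s t) i| <= C * omega s t `^ theta.

(* In the definitions of [sewing], [boxplus] and [Ext] below, [xget] selects an
   element of a set of maps that all agree on the simplex; the default value
   [zero_map] is only taken when this set is empty. *)
Definition zero_map (k : nat) : two_param k :=
  fun _ _ => mk_ttens k (fun=> 0).
Arguments zero_map : clear implicits.

Definition sewing (k : nat) (X : two_param k) : two_param k :=
  xget (zero_map k) [set Xbar | is_sewing X Xbar].

(** * The space H^p and the operation boxplus *)

Definition Hspace (p : R) : set (two_param (Num.truncn p)) :=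
  [set H | rough_path p H /\
    exists omega phi K,
      [/\ control omega, 1 - p^-1 < phi <= 1, 0 <= K &
        forall j, (1 <= j <= Num.truncn p)%N -> forall s t, simplex (s, t) ->
          `|lvl (H s t) j| <= K * omega s t `^ phi]].
Arguments Hspace : clear implicits.

Definition oplus (k : nat) (X H : two_param k) : two_param k :=
  fun s t => mk_ttens k (fun i =>
    match i return tpow i with
    | 0 => (1 : R^o)
    | j.+1 => lvl (X s t) j.+1 + lvl (H s t) j.+1
    end).

(* The guard records the domain rough_path p * Hspace p of boxplus. *)
Definition boxplus (p : R) (X H : two_param (Num.truncn p))
    : two_param (Num.truncn p) :=
  xget (zero_map (Num.truncn p))
    [set Y | [/\ rough_path p X, Hspace p H & Y = sewing (oplus X H)]].
Arguments boxplus : clear implicits.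

(** * Additive perturbations and the map I |-> 1^I *)

Definition Ispace (p phi : R) : set (two_param (Num.truncn p)) :=
  [set I |
    [/\ forall s t, simplex (s, t) -> lvl (I s t) 0 = 0,
        forall s u t, S <= s -> s <= u -> u <= t -> t <= T ->
          ttens_add (I s u) (I u t) = I s t &
        exists omega K,
          [/\ control omega, 0 <= K,
            forall j, (1 <= j <= Num.truncn p)%N ->
              forall s t, simplex (s, t) ->
              `|lvl (I s t) j| <= K * omega s t `^ phi &
            forall s t, simplex (s, t) ->
              `|lvl (I s t) (Num.truncn p)| <=
                K * omega s t `^ ((Num.truncn p)%:R / p)]]].
Arguments Ispace : clear implicits.

Definition Iadd (k : nat) (I J : two_param k) : two_param k :=
  fun s t => ttens_add (I s t) (J s t).

Definition is_ext (j : nat) (Z : two_param j) (Y : two_param j.+1) : Prop :=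
  exists q : R,
    [/\ 1 <= q < j.+1%:R, Omega j q Z, Omega j.+1 q Y &
      forall i, (i <= j)%N -> forall s t, simplex (s, t) ->
        lvl (Y s t) i = lvl (Z s t) i].

Definition Ext (j : nat) (Z : two_param j) : two_param j.+1 :=
  xget (zero_map j.+1) [set Y | is_ext Z Y].

(* (0, ..., 0, x) *)
Definition top_lvl (k : nat) (x : tpow k) : ttens k :=
  mk_ttens k (fun i =>
    if i =P k is ReflectT e then ecast n (tpow n) (esym e) x else 0).

(* [ind_upto I m] is 1^(0, I^1, ..., I^m); the recursion starts at m = 1, the
   value at m = 0 being the trivial functional. *)
Fixpoint ind_upto (k : nat) (I : two_param k) (m : nat) : two_param m :=
  match m return two_param m with
  | 0 => fun _ _ => mk_ttens 0 (fun i =>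
           match i return tpow i with 0 => (1 : R^o) | _.+1 => 0 end)
  | m'.+1 =>
      match m' return two_param m' -> two_param m'.+1 with
      | 0 => fun _ s t => mk_ttens 1 (fun i =>
               match i return tpow i with
               | 0 => (1 : R^o)
               | j.+1 => lvl (I s t) j.+1
               end)
      | m''.+1 => fun Z s t =>
          ttens_add (Ext Z s t) (top_lvl (lvl (I s t) m''.+2))
      end (@ind_upto k I m')
  end.

Definition ind (p : R) (I : two_param (Num.truncn p))
    : two_param (Num.truncn p) :=
  @ind_upto (Num.truncn p) I (Num.truncn p).
Arguments ind : clear implicits.

End RoughPaths.

Arguments mk_ttens {R V A} k f.
Arguments zero_map {R V A} k.
Arguments Omega {R V A} S T k p.
Arguments rough_path {R V A} S T p.
Arguments Hspace {R V A} S T p.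
Arguments boxplus {R V A} S T p X H.
Arguments Ispace {R V A} S T p phi.
Arguments ind_upto {R V A} S T {k} I m.
Arguments ind {R V A} S T p I.

(* Main.v *)
Require Import Defs.
From mathcomp Require Import all_boot all_order all_algebra.
From mathcomp Require Import all_classical all_reals all_analysis.
From mathcomp Require Import measurable_realfun ring lra.

(** All functionals in the statement are pinned down by orders of magnitude with
    respect to one control [w], the sum of the controls of [I] and [I'].

    By induction on the level, every level of [ind I] is of order [phi], and it
    differs from the same level of [I] by a term of order [2 * phi]: the
    extension [Ext] adds to level [i] a solution of Chen's relation, whose
    inhomogeneous part [chen_defect] is a sum of products of lower levels, hence
    of order [2 * phi]. From level two on, [phi > 1 - 1 / p >= 1 / 2], so that
    [2 * phi > 1]; at level one nothing is added. This applies to [I], to [I']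
    and to [I + I'], and as level [i] of [I + I'] is the sum of the levels of [I]
    and [I'], the functional [ind (I + I')] differs from the levelwise sum of
    [ind I] and [ind I'] by order [theta > 1]. Being multiplicative, it is
    therefore the sewing of that sum ([is_sewing_oplus], [sewing_unique]).

    Two facts about additive maps carry the analysis. An additive map of order
    greater than 1 is zero ([additive_small_eq0]); applied level by level, this
    gives uniqueness of sewings and of extensions. An almost additive map is
    close to an additive one ([additive_sewing]); through the cocycle identity
    for [chen_defect], this gives existence of the extension
    ([lyons_extension]). What remains is that the functionals so obtained are
    continuous ([multiplicative_of_bounds]) and that bounds by powers of [w] are
    the same as finite variation ([order_bound_pvar]), for which the normalising
    constants have to be positive. *)

Set Implicit Arguments.
Unset Strict Implicit.
Unset Printing Implicit Defensive.

Import Order.TTheory GRing.Theory Num.Theory.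
Import numFieldNormedType.Exports.

Local Open Scope classical_set_scope.
Local Open Scope ring_scope.

(** * Linear identities in abelian groups *)

(** Equalities between integer combinations of vectors are decided by comparing
    the coefficients of each vector on both sides. *)
Inductive zterm := ZVar of nat | ZZero | ZAdd of zterm & zterm | ZOpp of zterm.

Fixpoint zeval (E : zmodType) (env : seq E) (t : zterm) : E :=
  match t with
  | ZVar n => nth 0 env n
  | ZZero => 0
  | ZAdd a b => zeval env a + zeval env b
  | ZOpp a => - zeval env a
  end.

Fixpoint zcoef (t : zterm) (k : nat) : int :=
  match t with
  | ZVar n => (k == n)%:Z
  | ZZero => 0
  | ZAdd a b => zcoef a k + zcoef b k
  | ZOpp a => - zcoef a k
  end.

Lemma zevalE (E : zmodType) (env : seq E) (t : zterm) :
  zeval env t = \sum_(k < size env) nth 0 env k *~ zcoef t k.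
Proof.
elim: t => [n||a IHa b IHb|a IHa] /=; rewrite ?IHa ?IHb.
- have [nlt|nge] := ltnP n (size env).
    rewrite (bigD1 (Ordinal nlt)) //= eqxx big1 ?addr0 // => i /negPf ni.
    by rewrite -val_eqE /= in ni; rewrite ni.
  rewrite nth_default // big1 // => i _.
  by rewrite (ltn_eqF (leq_trans (ltn_ord i) nge)).
- by rewrite big1 // => i _; rewrite mulr0z.
- by rewrite -big_split /=; apply: eq_bigr => i _; rewrite mulrzDr.
- by rewrite -sumrN; apply: eq_bigr => i _; rewrite mulrNz.
Qed.

Lemma zeval_eq (E : zmodType) (env : seq E) (t1 t2 : zterm) :
  all (fun k => zcoef t1 k == zcoef t2 k) (iota 0 (size env)) ->
  zeval env t1 = zeval env t2.
Proof.
move=> /allP h; rewrite !zevalE; apply: eq_bigr => i _.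
by rewrite (eqP (h _ _)) // mem_iota /=.
Qed.

Ltac zfind x l :=
  lazymatch l with
  | x :: _ => constr:(O)
  | _ :: ?l' => let n := zfind x l' in constr:(S n)
  end.
Ltac zmem x l :=
  lazymatch l with
  | x :: _ => constr:(true)
  | _ :: ?l' => zmem x l'
  | _ => constr:(false)
  end.
Ltac zatoms e l :=
  lazymatch e with
  | (?a + ?b)%R => let l' := zatoms a l in zatoms b l'
  | (- ?a)%R => zatoms a l
  | 0%R => l
  | _ => lazymatch zmem e l with true => l | _ => constr:(e :: l) end
  end.
Ltac zreify e l :=
  lazymatch e with
  | (?a + ?b)%R =>
      let x := zreify a l in let y := zreify b l in constr:(ZAdd x y)
  | (- ?a)%R => let x := zreify a l in constr:(ZOpp x)
  | 0%R => constr:(ZZero)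
  | _ => let n := zfind e l in constr:(ZVar n)
  end.
Ltac zmod_eq :=
  lazymatch goal with
  | |- @eq ?E ?a ?b =>
    let l := zatoms a (@nil E) in
    let l := zatoms b l in
    let ta := zreify a l in
    let tb := zreify b l in
    refine (@zeval_eq _ l ta tb _); vm_compute; reflexivity
  end.

(** * Controls and their powers *)

Section ControlPowers.
Context {R : realType}.

(** Controls are bounded by their value on the whole interval, so a bound of
    order [a] implies one of any smaller positive order. *)
Lemma powR_weaken (x M a b : R) : 0 <= x <= M -> 0 < b -> b <= a ->
  x `^ a <= M `^ (a - b) * x `^ b.
Proof.
move=> /andP[x0 xM] b0 ba.
have [->|xn0] := eqVneq x 0.
  by rewrite !powR0 ?gt_eqF ?mulr0 // (lt_le_trans b0).
have -> : x `^ a = x `^ (a - b) * x `^ b.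
  by rewrite -powRD ?subrK //; apply/implyP.
apply: ler_wpM2r; first exact: powR_ge0.
by apply: ge0_ler_powR => //; rewrite ?subr_ge0 ?nnegrE // (le_trans x0).
Qed.

(** When an interval is cut at a point that halves the control, the sum of the
    two values of [w ^ theta] is at most this ratio times the value on the
    interval: [theta > 1] is what makes the sewing series geometric. *)
Lemma half_powR_lt1 (theta : R) : 1 < theta -> 2 * 2^-1 `^ theta < 1 :> R.
Proof.
move=> h.
have h2 : (0 : R) < 2^-1 by lra.
have -> : theta = 1 + (theta - 1) by ring.
rewrite powRD ?powRr1 ?(ltW h2) //; last by apply/implyP => _; rewrite gt_eqF.
rewrite mulrA divff // mul1r.
have : (2^-1 : R) `^ (theta - 1) < 1 `^ (theta - 1).
  by apply: gt0_ltr_powR; rewrite ?nnegrE; lra.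
by rewrite powR1.
Qed.

Lemma powR_le_half (theta x y : R) : 0 <= theta -> 0 <= x -> x <= y / 2 ->
  x `^ theta <= 2^-1 `^ theta * y `^ theta.
Proof.
move=> th0 x0 xy; rewrite -powRM ?invr_ge0 //; last by lra.
by apply: ge0_ler_powR => //; rewrite ?nnegrE ?mulr_ge0 ?invr_ge0 //; lra.
Qed.

Variables (S T : R) (w : R -> R -> R) (hw : control S T w).

Lemma control_ge0 s t : S <= s -> s <= t -> t <= T -> 0 <= w s t.
Proof. by case: hw => _ h _ _ *; apply: h; split. Qed.

Lemma control_diag t : S <= t -> t <= T -> w t t = 0.
Proof. by case: hw => _ _ h _ *; apply: h; split. Qed.

Lemma control_super s u t : S <= s -> s <= u -> u <= t -> t <= T ->
  w s u + w u t <= w s t.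
Proof. by case: hw => _ _ _ h; apply: h. Qed.

Lemma control_mono s s' t' t : S <= s -> s <= s' -> s' <= t' -> t' <= t ->
  t <= T -> w s' t' <= w s t.
Proof.
move=> h1 h2 h3 h4 h5.
have a1 := control_super h1 h2 (le_trans h3 h4) h5.
have a2 := control_super (le_trans h1 h2) h3 h4 h5.
have a3 := control_ge0 h1 h2 (le_trans h3 (le_trans h4 h5)).
have a4 := control_ge0 (le_trans (le_trans h1 h2) h3) h4 h5.
lra.
Qed.

Lemma control_powR_mono (theta : R) s s' t' t : 0 <= theta -> S <= s ->
  s <= s' -> s' <= t' -> t' <= t -> t <= T ->
  w s' t' `^ theta <= w s t `^ theta.
Proof.
move=> th h1 h2 h3 h4 h5; apply: ge0_ler_powR => //; rewrite ?nnegrE.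
- by apply: control_ge0 => //; [exact: le_trans h2|exact: le_trans h5].
- by apply: control_ge0 => //; exact: le_trans h2 (le_trans h3 h4).
- exact: control_mono.
Qed.

Lemma control_powR_mul (phi : R) s u t : 0 < phi -> S <= s -> s <= u ->
  u <= t -> t <= T -> w s u `^ phi * w u t `^ phi <= w s t `^ (2 * phi).
Proof.
move=> phi0 h1 h2 h3 h4; rewrite mulr_natl mulr2n powRD; last first.
  by apply/implyP; rewrite gt_eqF // addr_gt0.
by apply: ler_pM; rewrite ?powR_ge0 //; apply: control_powR_mono => //;
  exact: ltW.
Qed.

Lemma control_cvg s t : simplex S T (s, t) ->
  w z.1 z.2 @[z --> within (simplex S T) (nbhs (s, t))] --> w s t.
Proof. by case: hw => /subspace_continuousP /(_ (s, t)) + _ _ _. Qed.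

Lemma control_near_diag t (e : R) : S <= t -> t <= T -> 0 < e ->
  \forall z \near (t, t), simplex S T z -> w z.1 z.2 < e.
Proof.
move=> h1 h2 e0.
have /cvgr_dist_lt /(_ _ e0) :
    w z.1 z.2 @[z --> within (simplex S T) (nbhs (t, t))] --> w t t.
  exact: control_cvg.
rewrite control_diag // => H; near=> z => zs.
have : `|0 - w z.1 z.2| < e by move: zs; near: z; exact: H.
by rewrite sub0r normrN => /(le_lt_trans (ler_norm _)).
Unshelve. all: by end_near.
Qed.

(** The intermediate value theorem for [w s _] gives [w s m = w s t / 2], and
    superadditivity then bounds the other half. *)
Lemma control_midpoint s t : S <= s -> s <= t -> t <= T ->
  exists m, [/\ s <= m, m <= t, w s m <= w s t / 2 & w m t <= w s t / 2].
Proof.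
move=> h1 h2 h3.
have w0 := control_ge0 h1 h2 h3.
have ws : w s s = 0 by apply: control_diag => //; exact: le_trans h3.
have [] := @IVT R (w s) s t (w s t / 2) h2.
- apply/subspace_continuousP => u; rewrite /= in_itv /= => /andP[su ut].
  have H : w z.1 z.2 @[z --> within (simplex S T) (nbhs (s, u))] --> w s u.
    by apply: control_cvg; split => //=; exact: le_trans h3.
  apply: (@cvg_comp _ _ _ (fun u => (s, u)) (fun z => w z.1 z.2) _
    (within (simplex S T) (nbhs (s, u)))); last exact: H.
  move=> P [[P1 P2] [P1s P2u] PP].
  change (\forall v \near u, `[s, t]%classic v -> P (s, v)).
  near=> v; rewrite /= in_itv /= => /andP[sv vt].
  apply: PP => /=; last by split => //=; exact: le_trans h3.
  split => /=; first exact: nbhs_singleton.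
  by near: v.
- rewrite ws; apply/andP; split.
    by rewrite ge_min; apply/orP; left; lra.
  by rewrite le_max; apply/orP; right; lra.
- move=> m; rewrite in_itv /= => /andP[sm mt] wm.
  exists m; split => //; first by rewrite wm.
  by have := control_super h1 sm mt h3; rewrite wm; lra.
Unshelve. all: by end_near.
Qed.

Lemma controlD w' : control S T w' -> control S T (fun s t => w s t + w' s t).
Proof.
case: hw => a b c d [a' b' c' d']; split.
- by move=> x; apply: cvgD; [exact: a|exact: a'].
- by move=> s t h; rewrite addr_ge0 ?b ?b'.
- by move=> t h; rewrite c // c' // addr0.
- move=> s u t h1 h2 h3 h4.
  have := d _ _ _ h1 h2 h3 h4; have := d' _ _ _ h1 h2 h3 h4; lra.
Qed.

End ControlPowers.

(** * Additive sewing *)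

Section Limits.
Context {R : realType} {E : completeNormedModType R}.

Lemma geometric_cvg (u : nat -> E) (c r : R) : 0 <= r < 1 ->
  (forall n, `|u n.+1 - u n| <= c * r ^+ n) -> exists l : E, u @ \oo --> l.
Proof.
move=> /andP[r0 r1] h.
suff : cvgn u by move=> H; exists (limn u).
suff H : cvgn (series (fun n => u n.+1 - u n)).
  have -> : u = (fun n => u 0 + series (fun n => u n.+1 - u n) n).
    apply/funext => n; rewrite /series /= telescope_sumr // addrC subrK //.
  apply: is_cvgD => //; exact: is_cvg_cst.
apply: normed_cvg.
apply: (@series_le_cvg _ _ (geometric c r)) => //.
- by move=> n; exact: normr_ge0.
- by move=> n; exact: le_trans (normr_ge0 _) (h n).
- by apply: is_cvg_geometric_series; rewrite ger0_norm.
Qed.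

Lemma norm_lim_le (u : nat -> E) (l a : E) (C : R) :
  u @ \oo --> l -> (forall n, `|u n - a| <= C) -> `|l - a| <= C.
Proof.
move=> ul h.
have H : `|u n - a| @[n --> \oo] --> `|l - a|.
  by apply: cvg_norm; apply: cvgB => //; exact: cvg_cst.
by rewrite -(cvg_lim _ H) //; apply: limr_le; [apply: cvgP H|near=> n; exact: h].
Unshelve. all: by end_near.
Qed.

Lemma norm_lim0 (u : nat -> E) (l : E) (c r : R) : 0 <= r < 1 ->
  u @ \oo --> l -> (forall n, `|u n| <= c * r ^+ n) -> l = 0.
Proof.
move=> /andP[r0 r1] ul h.
apply: (cvg_unique _ ul) => //.
apply/cvgr0Pnorm_lt => e e0.
have /cvgr0Pnorm_lt/(_ e e0) H : geometric c r @ \oo --> 0.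
  by apply: cvg_geometric; rewrite ger0_norm.
near=> n; apply: (le_lt_trans (h n)).
apply: le_lt_trans (ler_norm _) _.
by near: n; exact: H.
Unshelve. all: by end_near.
Qed.

End Limits.

(** Cuts a chain at its first point satisfying [a]. With [a u] saying that
    [w s u] exceeds half of the total control, the parts on both sides of the
    step into [x] carry at most half of the control each. *)
Lemma split_first (X : eqType) (a : pred X) (s : X) (l : seq X) :
  ~~ a s -> l != [::] ->
  exists l1 x l2, [/\ l = l1 ++ x :: l2, ~~ a (last s l1) & a x \/ l2 = [::]].
Proof.
elim: l s => [|y [|z l] IH] s as_ // _.
  by exists [::], y, [::]; split => //; right.
have [ay|ay] := boolP (a y).
  by exists [::], y, (z :: l); split => //; left.
have [//|l1 [x [l2 [-> h1 h2]]]] := IH y ay.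
by exists (y :: l1), x, l2.
Qed.

Lemma path_le_last (R : realType) (s : R) l : path <=%R s l -> s <= last s l.
Proof. by elim: l s => //= y l IH s /andP[sy /IH]; exact: le_trans. Qed.

Section Sewing.
Context {R : realType} {E : completeNormedModType R}.
Variables (S T : R) (w : R -> R -> R) (hw : control S T w).
Variables (theta K : R) (theta1 : 1 < theta) (K0 : 0 <= K).
Variable A : R -> R -> E.
Hypothesis defectA : forall s u t, S <= s -> s <= u -> u <= t -> t <= T ->
  `|A s t - A s u - A u t| <= K * w s t `^ theta.

Let theta_ge0 : 0 <= theta. Proof. exact: ltW (lt_trans ltr01 theta1). Qed.

Lemma sewing_germ_diag t : S <= t -> t <= T -> A t t = 0.
Proof.
move=> h1 h2; have := defectA h1 (lexx t) (lexx t) h2.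
rewrite (control_diag hw) // powR0; last by rewrite gt_eqF // (lt_trans ltr01).
by rewrite mulr0 normr_le0 subrr sub0r oppr_eq0 => /eqP.
Qed.

Fixpoint path_sum (s : R) (l : seq R) : E :=
  if l is u :: l' then A s u + path_sum u l' else 0.

Lemma path_sum_cat s l1 l2 :
  path_sum s (l1 ++ l2) = path_sum s l1 + path_sum (last s l1) l2.
Proof. by elim: l1 s => [|u l1 IH] s /=; rewrite ?add0r // IH addrA. Qed.

(** The solution [C] of [C = C * (2 * 2^-1 `^ theta) + 2 * K], which is the
   recursion in the proof of [path_sum_near]. *)
Definition sewing_cst : R := 2 * K / (1 - 2 * 2^-1 `^ theta).

Lemma sewing_cst_ge0 : 0 <= sewing_cst.
Proof.
by rewrite divr_ge0 ?mulr_ge0 // subr_ge0 ltW // half_powR_lt1.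
Qed.

(** Riemann sums stay close to the germ, uniformly in the partition. By
    induction on the number of points: removing the step that crosses the
    half-way point of the control costs two defects, and the two remaining
    chains each carry at most half of the control. *)
Lemma path_sum_near l s : S <= s -> path <=%R s l -> last s l <= T ->
  `|path_sum s l - A s (last s l)| <= sewing_cst * w s (last s l) `^ theta.
Proof.
have [n] := ubnP (size l); elim: n l s => // n IH l s; rewrite ltnS => szl.
move=> Ss pl lT.
have [l0|l0] := eqVneq l [::].
  move: lT; rewrite l0 /= => sT; rewrite sewing_germ_diag // subr0 normr0.
  by rewrite mulr_ge0 ?powR_ge0 // sewing_cst_ge0.
set t := last s l in lT *.
have st : s <= t by exact: path_le_last.
have W0 : 0 <= w s t by exact: (control_ge0 hw).
pose a : pred R := fun u => w s t / 2 < w s u.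
have as_ : ~~ a s.
  rewrite /a (control_diag hw) ?(le_trans st) // -leNgt; lra.
have [l1 [x [l2 [E1 E2 E3]]]] := split_first as_ l0.
set v := last s l1 in E2.
have tE : t = last x l2 by rewrite /t E1 last_cat.
move: pl; rewrite E1 cat_path /= => /and3P[p1 vx p2].
have sv : s <= v by exact: path_le_last.
have xt : x <= t by rewrite tE; exact: path_le_last.
have wv : w s v <= w s t / 2 by rewrite leNgt.
have sx : s <= x by exact: le_trans vx.
have wx : w x t <= w s t / 2.
  case: E3 => [ax|E3].
    have := control_super hw Ss sx xt lT; move: ax; rewrite /a; lra.
  rewrite {1}tE E3 /= (control_diag hw); [lra|exact: le_trans sx|exact: le_trans lT].
have szE : (size l = size l1 + (size l2).+1)%N by rewrite E1 size_cat.
have vT : v <= T by exact: le_trans (le_trans vx (le_trans xt lT)).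
have Sv : S <= v by exact: le_trans sv.
have Sx : S <= x by exact: le_trans sx.
have I1 : `|path_sum s l1 - A s v| <= sewing_cst * w s v `^ theta.
  apply: IH => //; apply: leq_trans szl.
  by rewrite szE addnS ltnS leq_addr.
have I2 : `|path_sum x l2 - A x t| <= sewing_cst * w x t `^ theta.
  rewrite tE; apply: IH => //; rewrite -?tE //; apply: leq_trans szl.
  by rewrite szE addnS ltnS leq_addl.
have D1 := defectA Ss sv (le_trans vx xt) lT.
have D2 := defectA Sv vx xt lT.
have C0 := sewing_cst_ge0.
have H1 := powR_le_half theta_ge0 (control_ge0 hw Ss sv vT) wv.
have H2 := powR_le_half theta_ge0 (control_ge0 hw Sx xt lT) wx.
have H3 : w v t `^ theta <= w s t `^ theta.
  by apply: (control_powR_mono hw) => //; exact: le_trans xt.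
have -> : path_sum s (l1 ++ x :: l2) - A s t =
    (path_sum s l1 - A s v) + (path_sum x l2 - A x t)
    - (A s t - A s v - A v t) - (A v t - A v x - A x t).
  by rewrite path_sum_cat /= -/v; zmod_eq.
apply: le_trans (ler_normB _ _) _.
apply: le_trans (lerD (ler_normB _ _) (lexx _)) _.
apply: le_trans (lerD (lerD (ler_normD _ _) (lexx _)) (lexx _)) _.
have CE : sewing_cst * (2 * 2^-1 `^ theta) + 2 * K = sewing_cst.
  rewrite /sewing_cst; field.
  by rewrite subr_eq0 gt_eqF // half_powR_lt1.
rewrite -[X in _ <= X * _]CE.
have J1 := ler_wpM2l C0 H1; have J2 := ler_wpM2l C0 H2.
have J3 := ler_wpM2l K0 H3.
nra.
Qed.

Variable mid : R -> R -> R.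
Hypothesis midP : forall a b, S <= a -> a <= b -> b <= T ->
  [/\ a <= mid a b, mid a b <= b, w a (mid a b) <= w a b / 2 &
      w (mid a b) b <= w a b / 2].

(** The Riemann sum of [A] over [s, t] along the [n]-th dyadic partition of
    [a, b] for the control, intersected with [s, t]. Using the partitions of one
    fixed interval [a, b] for all [s, t] makes the sums additive up to the
    single cell that contains the intermediate point. *)
Fixpoint dyadic_sum (n : nat) (a b s t : R) : E :=
  if n is n'.+1 then
    let m := mid a b in
    if t <= m then dyadic_sum n' a m s t
    else if m <= s then dyadic_sum n' m b s t
    else dyadic_sum n' a m s m + dyadic_sum n' m b m t
  else A s t.

Lemma dyadic_sumS n a b s t : dyadic_sum n.+1 a b s t =
  if t <= mid a b then dyadic_sum n a (mid a b) s t
  else if mid a b <= s then dyadic_sum n (mid a b) b s t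
  else dyadic_sum n a (mid a b) s (mid a b) +
       dyadic_sum n (mid a b) b (mid a b) t.
Proof. by []. Qed.

Lemma dyadic_sum_diag n a b s : S <= s -> s <= T -> dyadic_sum n a b s s = 0.
Proof.
elim: n a b => [|n IH] a b h1 h2 /=; first exact: sewing_germ_diag.
by case: (lerP s (mid a b)) => h; rewrite ?(ltW h) IH.
Qed.

Lemma dyadic_sum_path n a b s t : s <= t ->
  exists l, [/\ path <=%R s l, last s l = t & dyadic_sum n a b s t = path_sum s l].
Proof.
elim: n a b s t => [|n IH] a b s t st /=.
  by exists [:: t] => /=; rewrite st addr0.
case: (lerP t (mid a b)) => tm; first exact: IH.
case: (lerP (mid a b) s) => ms; first exact: IH.
have [l1 [p1 e1 ->]] := IH a (mid a b) s (mid a b) (ltW ms).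
have [l2 [p2 e2 ->]] := IH (mid a b) b (mid a b) t (ltW tm).
exists (l1 ++ l2); rewrite cat_path last_cat p1 e1 p2 e2.
by rewrite path_sum_cat e1.
Qed.

Lemma dyadic_sum_near n a b s t : S <= s -> s <= t -> t <= T ->
  `|dyadic_sum n a b s t - A s t| <= sewing_cst * w s t `^ theta.
Proof.
move=> h1 h2 h3; have [l [p e ->]] := dyadic_sum_path n a b h2.
by rewrite -e; apply: path_sum_near => //; rewrite e.
Qed.

(** Each cell changes by at most [K * w ^ theta], hence by at most
    [K * (w a b / 2 ^ n) ^ (theta - 1) * w], and the remaining factors [w] add
    up by superadditivity. *)
Lemma dyadic_sum_step n a b s t :
  S <= a -> a <= s -> s <= t -> t <= b -> b <= T ->
  `|dyadic_sum n.+1 a b s t - dyadic_sum n a b s t| <=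
  K * (w a b / 2 ^+ n) `^ (theta - 1) * w s t.
Proof.
elim: n a b s t => [|n IH] a b s t h1 h2 h3 h4 h5.
  have [m1 m2 _ _] := midP h1 (le_trans h2 (le_trans h3 h4)) h5.
  have Ss := le_trans h1 h2; have tT := le_trans h4 h5.
  have w0 := control_ge0 hw Ss h3 tT.
  have rhs0 : 0 <= K * (w a b / 2 ^+ 0) `^ (theta - 1) * w s t.
    by rewrite !mulr_ge0 // powR_ge0.
  rewrite /=; case: (lerP t (mid a b)) => tm; first by rewrite subrr normr0.
  case: (lerP (mid a b) s) => ms; first by rewrite subrr normr0.
  have := defectA Ss (ltW ms) (ltW tm) tT.
  have -> : A s (mid a b) + A (mid a b) t - A s t =
      - (A s t - A s (mid a b) - A (mid a b) t) by zmod_eq.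
  rewrite normrN.
  move=> /le_trans; apply.
  rewrite -mulrA ler_wpM2l // expr0 divr1.
  have := @powR_weaken _ (w s t) (w a b) theta 1.
  rewrite powRr1 //; apply => //; last exact: ltW.
  by rewrite w0 (control_mono hw).
have ab := le_trans h2 (le_trans h3 h4).
have [m1 m2 w1 w2] := midP h1 ab h5.
have Ss := le_trans h1 h2; have tT := le_trans h4 h5.
have Sm := le_trans h1 m1; have mT := le_trans m2 h5.
rewrite (dyadic_sumS n.+1 a b s t) (dyadic_sumS n a b s t).
set m := mid a b in m1 m2 w1 w2 Sm mT *.
have scale (x : R) : 0 <= x -> x <= w a b / 2 ->
    K * (x / 2 ^+ n) `^ (theta - 1) <= K * (w a b / 2 ^+ n.+1) `^ (theta - 1).
  move=> x0 xw; apply: ler_wpM2l => //; apply: ge0_ler_powR.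
  - by rewrite subr_ge0 ltW.
  - by rewrite nnegrE divr_ge0 // exprn_ge0.
  - rewrite nnegrE divr_ge0 ?exprn_ge0 //; exact: (control_ge0 hw).
  rewrite exprS invfM mulrA; exact: ler_wpM2r.
have sL := scale _ (control_ge0 hw h1 m1 mT) w1.
have sR := scale _ (control_ge0 hw Sm m2 h5) w2.
case: (lerP t m) => tm.
  apply: le_trans (IH a m s t h1 h2 h3 tm mT) _.
  by apply: ler_wpM2r => //; exact: (control_ge0 hw).
case: (lerP m s) => ms.
  apply: le_trans (IH m b s t Sm ms h3 h4 h5) _.
  by apply: ler_wpM2r => //; exact: (control_ge0 hw).
rewrite (_ : _ - _ = (dyadic_sum n.+1 a m s m - dyadic_sum n a m s m) +
   (dyadic_sum n.+1 m b m t - dyadic_sum n m b m t)); last by zmod_eq.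
apply: le_trans (ler_normD _ _) _.
have i1 := IH a m s m h1 h2 (ltW ms) (lexx _) mT.
have i2 := IH m b m t Sm (lexx _) (ltW tm) h4 h5.
have p1 := control_ge0 hw Ss (ltW ms) mT.
have p2 := control_ge0 hw Sm (ltW tm) tT.
apply: le_trans (lerD i1 i2) _.
apply: le_trans (lerD (ler_wpM2r p1 sL) (ler_wpM2r p2 sR)) _.
rewrite -mulrDr; apply: ler_wpM2l; first by rewrite mulr_ge0 // powR_ge0.
apply: (control_super hw) => //; exact: ltW.
Qed.

(** Only the cell containing [u] contributes to the left-hand side. *)
Lemma dyadic_sum_additive n a b s u t :
  S <= a -> a <= s -> s <= u -> u <= t -> t <= b -> b <= T ->
  `|dyadic_sum n a b s t - dyadic_sum n a b s u - dyadic_sum n a b u t| <=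
  K * (w a b / 2 ^+ n) `^ theta.
Proof.
elim: n a b s u t => [|n IH] a b s u t h1 h2 h3 h4 h5 h6.
  rewrite expr0 divr1; have Ss := le_trans h1 h2; have tT := le_trans h5 h6.
  apply: le_trans (defectA Ss h3 h4 tT) _; apply: ler_wpM2l => //.
  by apply: (control_powR_mono hw) => //; exact: le_trans h4.
have ab := le_trans h2 (le_trans h3 (le_trans h4 h5)).
have [m1 m2 w1 w2] := midP h1 ab h6.
have Sm := le_trans h1 m1; have mT := le_trans m2 h6.
rewrite !dyadic_sumS; set m := mid a b in m1 m2 w1 w2 Sm mT *.
have scale (x : R) : 0 <= x -> x <= w a b / 2 ->
    K * (x / 2 ^+ n) `^ theta <= K * (w a b / 2 ^+ n.+1) `^ theta.
  move=> x0 xw; apply: ler_wpM2l => //; apply: ge0_ler_powR => //.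
  - by rewrite nnegrE divr_ge0 // exprn_ge0.
  - rewrite nnegrE divr_ge0 ?exprn_ge0 //; exact: (control_ge0 hw).
  rewrite exprS invfM mulrA; exact: ler_wpM2r.
have sL := scale _ (control_ge0 hw h1 m1 mT) w1.
have sR := scale _ (control_ge0 hw Sm m2 h6) w2.
have rhs0 : 0 <= K * (w a b / 2 ^+ n.+1) `^ theta.
  by rewrite mulr_ge0 // powR_ge0.
case: (lerP t m) => tm.
  rewrite (le_trans h4 tm).
  exact: le_trans (IH a m s u t h1 h2 h3 h4 tm mT) sL.
case: (lerP m s) => ms.
  rewrite (le_trans ms h3).
  case: (lerP u m) => um.
    (* then s = u = m, and the left-hand sum runs over a trivial interval *)
    have su : s = u by apply/eqP; rewrite eq_le h3 (le_trans um ms).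
    have Ss := le_trans h1 h2; have sT := le_trans (le_trans h3 um) mT.
    by rewrite -su (dyadic_sum_diag _ _ _ Ss) // subr0 subrr normr0.
  exact: le_trans (IH m b s u t Sm ms h3 h4 h5 h6) sR.
case: (lerP u m) => um.
  case: (lerP m u) => mu.
    have -> : u = m by apply/eqP; rewrite eq_le um mu.
    by rewrite (_ : _ - _ - _ = 0) ?normr0 //; zmod_eq.
  rewrite (_ : _ - _ - _ = dyadic_sum n a m s m - dyadic_sum n a m s u -
    dyadic_sum n a m u m); last by zmod_eq.
  exact: le_trans (IH a m s u m h1 h2 h3 um (lexx _) mT) sL.
rewrite (ltW um).
rewrite (_ : _ - _ - _ = dyadic_sum n m b m t - dyadic_sum n m b m u -
  dyadic_sum n m b u t); last by zmod_eq.
exact: le_trans (IH m b m u t Sm (lexx _) (ltW um) h4 h5 h6) sR.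
Qed.

End Sewing.

Section SewingTheorem.
Context {R : realType} {E : completeNormedModType R}.
Variables (S T : R) (w : R -> R -> R) (hw : control S T w).

Let ratio_powR (x : R) n (al : R) : 0 <= x ->
  (x / 2 ^+ n) `^ al = x `^ al * (2^-1 `^ al) ^+ n.
Proof.
move=> x0; elim: n => [|n IH]; first by rewrite !expr0 divr1 mulr1.
rewrite exprSr invfM mulrA powRM ?invr_ge0 ?mulr_ge0 ?invr_ge0 ?exprn_ge0 //.
by rewrite IH exprS; ring.
Qed.

Let half_powR_range (al : R) : 0 < al -> 0 <= (2^-1 : R) `^ al < 1.
Proof.
move=> al0; rewrite powR_ge0 /=.
have : (2^-1 : R) `^ al < 1 `^ al.
  by apply: gt0_ltr_powR; rewrite ?nnegrE //; lra.
by rewrite powR1.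
Qed.

(** The limit of the dyadic sums: they converge geometrically, their defect from
    additivity vanishes in the limit, and they stay close to [A] by
    [path_sum_near]. *)
Theorem additive_sewing (theta K : R) (A : R -> R -> E) : 1 < theta -> 0 <= K ->
  (forall s u t, S <= s -> s <= u -> u <= t -> t <= T ->
    `|A s t - A s u - A u t| <= K * w s t `^ theta) ->
  exists B : R -> R -> E,
    (forall s u t, S <= s -> s <= u -> u <= t -> t <= T ->
       B s t = B s u + B u t) /\
    exists2 C, 0 <= C & forall s t, S <= s -> s <= t -> t <= T ->
      `|B s t - A s t| <= C * w s t `^ theta.
Proof.
move=> theta1 K0 defectA.
have [mid midP] : exists mid : R -> R -> R, forall a b,
    S <= a -> a <= b -> b <= T ->
    [/\ a <= mid a b, mid a b <= b, w a (mid a b) <= w a b / 2 &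
        w (mid a b) b <= w a b / 2].
  have /choice [f fP] : forall ab : R * R, exists m, S <= ab.1 -> ab.1 <= ab.2 ->
      ab.2 <= T -> [/\ ab.1 <= m, m <= ab.2, w ab.1 m <= w ab.1 ab.2 / 2 &
        w m ab.2 <= w ab.1 ab.2 / 2].
    move=> [a b] /=; have [[h1 h2 h3]|h] := pselect [/\ S <= a, a <= b & b <= T].
      by have [m mP] := control_midpoint hw h1 h2 h3; exists m.
    by exists 0 => h1 h2 h3; case: h.
  by exists (fun a b => f (a, b)) => a b; exact: (fP (a, b)).
pose X s t n := dyadic_sum A mid n S T s t.
have cvgX s t : S <= s -> s <= t -> t <= T -> exists l : E, X s t @ \oo --> l.
  move=> h1 h2 h3; have ST := le_trans h1 (le_trans h2 h3).
  have W0 := control_ge0 hw (lexx S) ST (lexx T).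
  apply: (@geometric_cvg _ _ _ (K * w S T `^ (theta - 1) * w s t)
    (2^-1 `^ (theta - 1))); first by apply: half_powR_range; rewrite subr_gt0.
  move=> n; have := dyadic_sum_step hw theta1 K0 defectA midP n
    (lexx S) h1 h2 h3 (lexx T).
  rewrite ratio_powR // => /le_trans; apply.
  by rewrite le_eqVlt; apply/orP; left; apply/eqP; ring.
have [B BP] : exists B : R -> R -> E, forall s t, S <= s -> s <= t -> t <= T ->
    X s t @ \oo --> B s t.
  have /choice [f fP] : forall st : R * R, exists l : E, S <= st.1 ->
      st.1 <= st.2 -> st.2 <= T -> X st.1 st.2 @ \oo --> l.
    move=> [s t] /=; have [[h1 h2 h3]|h] := pselect [/\ S <= s, s <= t & t <= T].
      by have [l lP] := cvgX _ _ h1 h2 h3; exists l.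
    by exists 0 => h1 h2 h3; case: h.
  by exists (fun a b => f (a, b)) => a b; exact: (fP (a, b)).
exists B; split; last first.
  exists (sewing_cst theta K); first exact: sewing_cst_ge0.
  move=> s t h1 h2 h3; apply: norm_lim_le (BP _ _ h1 h2 h3) _ => n.
  exact: (dyadic_sum_near hw theta1 K0 defectA).
move=> s u t h1 h2 h3 h4.
have ST := le_trans h1 (le_trans h2 (le_trans h3 h4)).
have W0 := control_ge0 hw (lexx S) ST (lexx T).
have c1 := BP s t h1 (le_trans h2 h3) h4.
have c2 := BP s u h1 h2 (le_trans h3 h4).
have c3 := BP u t (le_trans h1 h2) h3 h4.
apply/eqP; rewrite -subr_eq0 opprD addrA; apply/eqP.
apply: (@norm_lim0 _ _ (fun n => X s t n - X s u n - X u t n) _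
  (K * w S T `^ theta) (2^-1 `^ theta)).
- by apply: half_powR_range; lra.
- by apply: cvgB => //; apply: cvgB.
- move=> n; have := dyadic_sum_additive hw theta1 K0 defectA midP n
    (lexx S) h1 h2 h3 h4 (lexx T).
  by rewrite ratio_powR // mulrA.
Qed.

(** Halving the control divides the bound by [2 ^ (theta - 1)], while additivity
    keeps the value: the bound can thus be iterated down to zero. *)
Theorem additive_small_eq0 (theta C : R) (D : R -> R -> E) : 1 < theta ->
  (forall s u t, S <= s -> s <= u -> u <= t -> t <= T ->
    D s t = D s u + D u t) ->
  (forall s t, S <= s -> s <= t -> t <= T -> `|D s t| <= C * w s t `^ theta) ->
  forall s t, S <= s -> s <= t -> t <= T -> D s t = 0.
Proof.
move=> theta1 addD smallD.
set r : R := 2 * 2^-1 `^ theta.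
have r0 : 0 <= r by rewrite mulr_ge0 // powR_ge0.
have r1 : r < 1 by exact: half_powR_lt1.
have theta0 : 0 <= theta by exact: ltW (lt_trans ltr01 theta1).
have it n : forall s t, S <= s -> s <= t -> t <= T ->
    `|D s t| <= `|C| * w s t `^ theta * r ^+ n.
  elim: n => [|n IH] s t h1 h2 h3.
    rewrite expr0 mulr1; apply: le_trans (smallD _ _ h1 h2 h3) _.
    by rewrite ler_wpM2r ?powR_ge0 // ler_norm.
  have [m [sm mt w1 w2]] := control_midpoint hw h1 h2 h3.
  have mT := le_trans mt h3; have Sm := le_trans h1 sm.
  rewrite (addD _ _ _ h1 sm mt h3); apply: le_trans (ler_normD _ _) _.
  have H1 := powR_le_half theta0 (control_ge0 hw h1 sm mT) w1.
  have H2 := powR_le_half theta0 (control_ge0 hw Sm mt h3) w2.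
  have i1 := IH _ _ h1 sm mT; have i2 := IH _ _ Sm mt h3.
  apply: le_trans (lerD i1 i2) _.
  have rn : 0 <= `|C| * r ^+ n by rewrite mulr_ge0 // exprn_ge0.
  have J1 := ler_wpM2l rn H1; have J2 := ler_wpM2l rn H2.
  rewrite exprS {3}/r; move: J1 J2; set a := `|C|; set b := r ^+ n; lra.
move=> s t h1 h2 h3.
apply: (@norm_lim0 _ _ (fun=> D s t) _ (`|C| * w s t `^ theta) r).
- by rewrite r0.
- exact: cvg_cst.
- by move=> n; exact: it.
Qed.

End SewingTheorem.

(** * Graded families and Chen's relation *)

Section GradedFamilies.
Context {R : realType} {V : completeNormedModType R} {A : tensor_algebra V}.

Local Notation family := (forall n, tpow A n).

Lemma tmulDl m n (x x' : tpow A m) (y : tpow A n) :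
  tmul (x + x') y = tmul x y + tmul x' y.
Proof. by have := ta_mul_linearl y 1 x x'; rewrite !scale1r. Qed.

Lemma tmulDr m n (x : tpow A m) (y y' : tpow A n) :
  tmul x (y + y') = tmul x y + tmul x y'.
Proof. by have := ta_mul_linearr x 1 y y'; rewrite !scale1r. Qed.

Lemma tmul0l m n (y : tpow A n) : tmul (0 : tpow A m) y = 0.
Proof. by apply: (addIr (tmul 0 y)); rewrite -tmulDl !add0r. Qed.

Lemma tmul0r m n (x : tpow A m) : tmul x (0 : tpow A n) = 0.
Proof. by apply: (addIr (tmul x 0)); rewrite -tmulDr !add0r. Qed.

Lemma norm_tmul m n (x : tpow A m) (y : tpow A n) : `|tmul x y| <= `|x| * `|y|.
Proof. exact: ta_norm_mul. Qed.

(** Transport between tensor powers of provably equal degrees, extended by zero: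
    being total, it turns convolution products into plain double sums. *)
Definition tcast m n (x : tpow A m) : tpow A n :=
  if m =P n is ReflectT e then ecast k (tpow A k) e x else 0.

Lemma tcastE m n (e : m = n) (x : tpow A m) :
  tcast n x = ecast k (tpow A k) e x.
Proof. by rewrite /tcast; case: eqP => // e'; rewrite (eq_irrelevance e' e). Qed.

Lemma tcast_id n (x : tpow A n) : tcast n x = x.
Proof. by rewrite (tcastE (erefl n)). Qed.

Lemma tcast_neq m n (x : tpow A m) : m != n -> tcast n x = 0.
Proof. by rewrite /tcast; case: eqP. Qed.

Lemma tcastD m n (x y : tpow A m) : tcast n (x + y) = tcast n x + tcast n y.
Proof.
have [e|/eqP ne] := eqVneq m n; first by subst n; rewrite !tcast_id.
by rewrite !tcast_neq ?addr0 //; apply/eqP.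
Qed.

Lemma tcast0 m n : tcast n (0 : tpow A m) = 0.
Proof. by apply: (addIr (tcast n (0 : tpow A m))); rewrite -tcastD !add0r. Qed.

Lemma norm_tcast m n (x : tpow A m) : `|tcast n x| <= `|x|.
Proof.
have [e|ne] := eqVneq m n; first by subst n; rewrite tcast_id.
by rewrite tcast_neq // normr0.
Qed.

Lemma tcast_ecast m m' n (e : m = m') (x : tpow A m) :
  tcast n (ecast k (tpow A k) e x) = tcast n x.
Proof. by case: _ / e. Qed.

Lemma tcast_tmulA i m n l (x : tpow A m) (y : tpow A n) (z : tpow A l) :
  tcast i (tmul (tmul x y) z) = tcast i (tmul x (tmul y z)).
Proof. by have := ta_mulA x y z; rewrite /tmul => <-; rewrite tcast_ecast. Qed.

Lemma tcast_tmul_castl i m n l (e : m = n) (x : tpow A m) (z : tpow A l) :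
  tcast i (tmul (tcast n x) z) = tcast i (tmul x z).
Proof. by subst n; rewrite tcast_id. Qed.

Lemma tcast_tmul_castr i m n l (e : m = n) (x : tpow A m) (z : tpow A l) :
  tcast i (tmul z (tcast n x)) = tcast i (tmul z x).
Proof. by subst n; rewrite tcast_id. Qed.

Definition convol (a b : family) : family := fun i =>
  \sum_(0 <= j < i.+1) tcast i (tmul (a j) (b (i - j)%N)).

Lemma convol_wide N (a b : family) i : (i <= N)%N ->
  convol a b i = \sum_(j < N.+1) \sum_(k < N.+1) tcast i (tmul (a j) (b k)).
Proof.
move=> iN; have iN' : (i.+1 <= N.+1)%N by [].
rewrite /convol big_mkord (big_ord_widen N.+1
  (fun j => tcast i (tmul (a j) (b (i - j)%N))) iN') big_mkcond /=.
apply: eq_bigr => j _; case: ltnP => ji.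
  have lt_ij : (i - j < N.+1)%N by rewrite ltnS (leq_trans (leq_subr _ _)).
  rewrite (bigD1 (Ordinal lt_ij)) //= big1 ?addr0 // => k /negP kne.
  apply: tcast_neq; apply/eqP => e; apply: kne; apply/eqP/val_inj => /=.
  by rewrite -e addKn.
rewrite big1 // => k _; apply: tcast_neq.
by rewrite gtn_eqF // (leq_trans ji) // leq_addr.
Qed.

Lemma tmul_suml I (r : seq I) m n (F : I -> tpow A m) (y : tpow A n) :
  tmul (\sum_(i <- r) F i) y = \sum_(i <- r) tmul (F i) y.
Proof.
exact: (big_morph (fun x => tmul x y) (fun x x' => tmulDl x x' y) (tmul0l m y)).
Qed.

Lemma tmul_sumr I (r : seq I) m n (x : tpow A m) (F : I -> tpow A n) :
  tmul x (\sum_(i <- r) F i) = \sum_(i <- r) tmul x (F i).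
Proof. exact: (big_morph (tmul x) (tmulDr x) (tmul0r n x)). Qed.

Lemma tcast_sum I (r : seq I) m n (F : I -> tpow A m) :
  tcast n (\sum_(i <- r) F i) = \sum_(i <- r) tcast n (F i).
Proof. exact: (big_morph (@tcast m n) (@tcastD m n) (tcast0 m n)). Qed.

Lemma convolA (a b c : family) i :
  convol (convol a b) c i = convol a (convol b c) i.
Proof.
rewrite !(convol_wide _ _ (leqnn i)).
have L : forall m l : 'I_i.+1, tcast i (tmul (convol a b m) (c l)) =
    \sum_(j < i.+1) \sum_(k < i.+1)
      tcast i (tmul (tcast m (tmul (a j) (b k))) (c l)).
  move=> m l; rewrite (convol_wide _ _ (leq_ord m)) tmul_suml tcast_sum.
  by apply: eq_bigr => j _; rewrite tmul_suml tcast_sum.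
have Rr : forall j m : 'I_i.+1, tcast i (tmul (a j) (convol b c m)) =
    \sum_(k < i.+1) \sum_(l < i.+1)
      tcast i (tmul (a j) (tcast m (tmul (b k) (c l)))).
  move=> j m; rewrite (convol_wide _ _ (leq_ord m)) tmul_sumr tcast_sum.
  by apply: eq_bigr => k _; rewrite tmul_sumr tcast_sum.
transitivity (\sum_(j < i.+1) \sum_(k < i.+1) \sum_(l < i.+1)
    tcast i (tmul (tmul (a j) (b k)) (c l))).
  rewrite exchange_big /=.
  under eq_bigr => l _ do under eq_bigr => m _ do rewrite L.
  under eq_bigr => l _.
    rewrite exchange_big /=.
    under eq_bigr => j _ do rewrite exchange_big /=.
    over.
  rewrite exchange_big /=; apply: eq_bigr => j _.
  rewrite exchange_big /=; apply: eq_bigr => k _; apply: eq_bigr => l _.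
  have [jk|jk] := ltnP (j + k) i.+1.
    rewrite (bigD1 (Ordinal jk)) //= tcast_tmul_castl // big1 ?addr0 // => m mn.
    rewrite (@tcast_neq (j + k)) ?tmul0l ?tcast0 //.
    by apply: contraNneq mn => e; apply/eqP/val_inj.
  rewrite big1 => [|m _].
    by rewrite tcast_neq // gtn_eqF // (leq_trans jk) // leq_addr.
  rewrite (@tcast_neq (j + k)) ?tmul0l ?tcast0 //.
  by rewrite gtn_eqF // (leq_trans (ltn_ord m)).
apply: eq_bigr => j _.
under [RHS]eq_bigr => m _ do rewrite Rr.
rewrite exchange_big /= [RHS]exchange_big /=.
under [RHS]eq_bigr => k _ do rewrite exchange_big /=.
rewrite exchange_big /=.
apply: eq_bigr => k _; apply: eq_bigr => l _; rewrite tcast_tmulA.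
have [kl|kl] := ltnP (k + l) i.+1.
  rewrite (bigD1 (Ordinal kl)) //= tcast_tmul_castr // big1 ?addr0 // => m mn.
  rewrite (@tcast_neq (k + l)) ?tmul0r ?tcast0 //.
  by apply: contraNneq mn => e; apply/eqP/val_inj.
rewrite big1 => [|m _].
  by rewrite tcast_neq // gtn_eqF // (leq_trans kl) // leq_addl.
rewrite (@tcast_neq (k + l)) ?tmul0r ?tcast0 //.
by rewrite gtn_eqF // (leq_trans (ltn_ord m)).
Qed.

(** The inner terms of the convolution: for families with unit scalar part,
    Chen's relation says that additivity at level [i] fails by exactly this. *)
Definition chen_defect i (a b : family) : tpow A i :=
  \sum_(1 <= j < i) tcast i (tmul (a j) (b (i - j)%N)).

Lemma convol0 (a b : family) : a 0 = (1 : R^o) -> b 0 = (1 : R^o) ->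
  convol a b 0 = (1 : R^o).
Proof.
move=> a0 b0; rewrite /convol big_nat1 subn0 a0 b0 (tcast_id (n := 0)).
by rewrite [LHS](ta_mul0l (1 : R^o)) scale1r.
Qed.

Lemma convolE (a b : family) i : (0 < i)%N -> a 0 = (1 : R^o) ->
  b 0 = (1 : R^o) -> convol a b i = a i + b i + chen_defect i a b.
Proof.
case: i => // i _ a0 b0.
rewrite /convol big_nat_recr //= big_ltn // -/(chen_defect i.+1 a b).
have -> : tcast i.+1 (tmul (a 0) (b (i.+1 - 0)%N)) = b i.+1.
  rewrite subn0 a0 (tcast_id (n := i.+1)) [LHS](ta_mul0l (1 : R^o)).
  by rewrite scale1r.
have -> : tcast i.+1 (tmul (a i.+1) (b (i.+1 - i.+1)%N)) = a i.+1.
  by rewrite subnn b0 (tcastE (addn0 _)) [LHS](ta_mul0r _ (1 : R^o)) scale1r.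
by zmod_eq.
Qed.

(** Associativity of the convolution, with the linear terms cancelled. *)
Lemma chen_defect_cocycle (a b c : family) i : (0 < i)%N ->
  a 0 = (1 : R^o) -> b 0 = (1 : R^o) -> c 0 = (1 : R^o) ->
  chen_defect i (convol a b) c + chen_defect i a b =
  chen_defect i a (convol b c) + chen_defect i b c.
Proof.
move=> i0 a0 b0 c0; have := convolA a b c i.
rewrite (convolE i0 (convol0 a0 b0) c0) (convolE i0 a0 (convol0 b0 c0)).
rewrite (convolE i0 a0 b0) (convolE i0 b0 c0).
move=> /(congr1 (fun x => x - a i - b i - c i)) E; apply: (etrans _ (etrans E _)); zmod_eq.
Qed.

Lemma eq_chen_defect i (a a' b b' : family) :
  (forall j, (0 < j < i)%N -> a j = a' j) ->
  (forall j, (0 < j < i)%N -> b j = b' j) ->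
  chen_defect i a b = chen_defect i a' b'.
Proof.
move=> aE bE; rewrite /chen_defect !big_nat; apply: eq_bigr => j /andP[j0 ji].
by rewrite aE ?j0 // bE // subn_gt0 ji ltn_subrL j0 (leq_ltn_trans _ ji).
Qed.

Lemma norm_chen_defect i (a b : family) :
  `|chen_defect i a b| <= \sum_(1 <= j < i) `|a j| * `|b (i - j)%N|.
Proof.
apply: le_trans (ler_norm_sum _ _ _) _; apply: ler_sum => j _.
exact: le_trans (norm_tcast _ _) (norm_tmul _ _).
Qed.

Lemma lvl_gt k (a : ttens A k) i : (k < i)%N -> lvl a i = 0.
Proof.
move=> ki; rewrite /lvl; case: {-}_ / idP => // ik.
by have := ik; rewrite ltnS leqNgt ki.
Qed.

Lemma ttens_ext k (a b : ttens A k) :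
  (forall i, (i <= k)%N -> lvl a i = lvl b i) -> a = b.
Proof.
move=> h; apply: functional_extensionality_dep => -[i lt_ik].
have := h i lt_ik; rewrite /lvl; case: {-}_ / idP => // lt_ik'.
by rewrite (bool_irrelevance lt_ik' lt_ik).
Qed.

Lemma lvl_mul k (a b : ttens A k) i : (i <= k)%N ->
  lvl (ttens_mul a b) i = convol (lvl a) (lvl b) i.
Proof.
move=> ik; rewrite /ttens_mul lvl_mk_ttens // /convol big_mkord.
by apply: eq_bigr => j _; rewrite -tcastE.
Qed.

Lemma lvl_add k (a b : ttens A k) i :
  lvl (ttens_add a b) i = lvl a i + lvl b i.
Proof.
have [ik|ik] := leqP i k; first by rewrite /ttens_add lvl_mk_ttens.
by rewrite !lvl_gt // addr0.
Qed.

Lemma lvl_top k (x : tpow A k) i :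
  lvl (top_lvl x) i = tcast i x.
Proof.
have [ik|ik] := leqP i k; last by rewrite lvl_gt // tcast_neq // ltn_eqF.
rewrite /top_lvl lvl_mk_ttens //.
case: eqP => [e|ne]; first by rewrite (tcastE (esym e)).
by rewrite tcast_neq //; apply/eqP => e; apply: ne.
Qed.

End GradedFamilies.

(** * Positivity of the normalising constants *)

Section Gamma.
Context {R : realType}.
Notation mu := (@lebesgue_measure R).

Let powR_le_expR (a t : R) : 0 < a -> 0 <= t ->
  t `^ a <= (2 * a) `^ a * expR (t / 2).
Proof.
move=> a0 t0.
have a2 : 0 < 2 * a by rewrite mulr_gt0.
have h : t <= 2 * a * expR (t / (2 * a)).
  rewrite mulrC -ler_pdivrMr //; apply: le_trans (expR_ge1Dx _); lra.
have : t `^ a <= (2 * a * expR (t / (2 * a))) `^ a.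
  by apply: ge0_ler_powR => //; rewrite ?nnegrE ?mulr_ge0 ?expR_ge0 //; lra.
rewrite powRM ?expR_ge0 ?(ltW a2) // {3}/powR gt_eqF ?expR_gt0 // expRK.
by rewrite (_ : a * (t / (2 * a)) = t / 2) //; field; rewrite gt_eqF.
Qed.

Let integrand_measurable (x : R) (D : set R) :
  measurable_fun D (fun t : R => t `^ x * expR (- t)).
Proof.
apply: measurable_funTS; apply: measurable_funM; first exact: measurable_powR.
by apply: measurableT_comp => //; exact: measurable_funN.
Qed.

(** [fine] sends an infinite integral to zero, so positivity also requires
    convergence: [t ^ a * exp (- t)] is dominated by a multiple of the density
    of an exponential law. *)
Lemma Gamma_gt0 (x : R) : 1 < x -> 0 < Gamma x.
Proof.
move=> x1; rewrite /Gamma; set a := x - 1.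
have a0 : 0 < a by rewrite subr_gt0.
have mD : measurable (`]0%R, +oo[ : set R) by exact: measurable_itv.
have mE : measurable (`[1%R, 2%R] : set R) by exact: measurable_itv.
have f0 (t : R) : 0 <= t `^ a * expR (- t).
  by rewrite mulr_ge0 ?powR_ge0 ?expR_ge0.
have fin : mu.-integrable `]0, +oo[ (fun t => (t `^ a * expR (- t))%:E).
  have ipdf : mu.-integrable `]0, +oo[
      (fun t => ((2 * (2 * a) `^ a)%:E * (exponential_pdf 2^-1 t)%:E)%E).
    apply: integrableZl => //.
    by apply: (integrableS measurableT) => //; exact: integrable_exponential_pdf.
  apply: le_integrable ipdf => //.
    by apply/measurable_EFinP; exact: integrand_measurable.
  move=> t; rewrite /= in_itv /= andbT => t0.
  rewrite lee_fin ger0_norm //.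
  apply: le_trans (ler_norm _).
  rewrite exponential_pdfE ?(ltW t0) //.
  apply: le_trans (ler_wpM2r (expR_ge0 _) (powR_le_expR a0 (ltW t0))) _.
  rewrite -mulrA -expRD (_ : t / 2 - t = - 2^-1 * t); last by field.
  rewrite le_eqVlt; apply/orP; left; apply/eqP; by field.
rewrite /Rintegral; apply: fine_gt0; apply/andP; split; last exact: integrable_lty.
apply: (@lt_le_trans _ _ (\int[mu]_(t in `[1%R, 2%R]) (cst (expR (- 2))%:E t))%E).
  rewrite integral_cst //= lebesgue_measure_itv /= lte_fin ltr1n.
  by rewrite -EFinD -EFinM lte_fin mulr_gt0 ?expR_gt0 //; lra.
apply: (@le_trans _ _ (\int[mu]_(t in `[1%R, 2%R]) (t `^ a * expR (- t))%:E)%E).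
  apply: ge0_le_integral => //.
  - by move=> t _ /=; rewrite lee_fin expR_ge0.
  - by apply/measurable_EFinP; exact: integrand_measurable.
  move=> t; rewrite /= in_itv /= => /andP[t1 t2]; rewrite lee_fin.
  rewrite -[leLHS]mul1r; apply: ler_pM; rewrite ?expR_ge0 //.
    have : 1 `^ a <= t `^ a :> R.
      by apply: ge0_ler_powR => //; rewrite ?nnegrE //; lra.
    by rewrite powR1.
  by rewrite ler_expR lerN2.
apply: ge0_subset_integral => //.
- by apply/measurable_EFinP; exact: integrand_measurable.
- by move=> t _; rewrite lee_fin.
- by move=> t /=; rewrite !in_itv /= => /andP[t1 _]; rewrite andbT (lt_le_trans _ t1).
Qed.

(** Nonnegativity of the [limn] term is enough; its value in the absence of a
    limit is 0. *)
Lemma beta_cst_gt0 (p : R) : 0 < p -> 0 < beta_cst p.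
Proof.
move=> p0; rewrite /beta_cst mulr_gt0 //.
set u := (fun n => _).
have u0 n : 0 <= u n by apply: sumr_ge0 => i _; exact: powR_ge0.
suff : 0 <= limn u by lra.
have [cu|/dvgP ->] := pselect (cvgn u); last by rewrite lexx.
by apply: limr_ge => //; near=> n; exact: u0.
Unshelve. all: by end_near.
Qed.
End Gamma.

(** * Orders of magnitude with respect to a control *)

Section OrderBounds.
Context {R : realType} (S T : R).

(** [f = O(w ^ a)] on the simplex. *)
Definition order_bound (w : R -> R -> R) (a : R) (f : R -> R -> R) : Prop :=
  exists2 C, 0 <= C & forall s t, S <= s -> s <= t -> t <= T ->
    f s t <= C * w s t `^ a.

Lemma order_bound_le w a f g :
  (forall s t, S <= s -> s <= t -> t <= T -> f s t <= g s t) ->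
  order_bound w a g -> order_bound w a f.
Proof.
move=> fg [C C0 h]; exists C => // s t h1 h2 h3.
exact: le_trans (fg _ _ h1 h2 h3) (h _ _ h1 h2 h3).
Qed.

Lemma order_bound0 w a f :
  (forall s t, S <= s -> s <= t -> t <= T -> f s t <= 0) -> order_bound w a f.
Proof. by move=> f0; exists 0 => // s t *; rewrite mul0r f0. Qed.

Lemma order_boundD w a f g : order_bound w a f -> order_bound w a g ->
  order_bound w a (fun s t => f s t + g s t).
Proof.
move=> [C C0 h] [D D0 h']; exists (C + D); first exact: addr_ge0.
by move=> s t h1 h2 h3; rewrite mulrDl lerD ?h ?h'.
Qed.

Lemma order_bound_weaken w a b f : control S T w -> 0 < b -> b <= a ->
  order_bound w a f -> order_bound w b f.
Proof.
move=> hw b0 ba [C C0 h]; exists (C * w S T `^ (a - b)).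
  by rewrite mulr_ge0 ?powR_ge0.
move=> s t h1 h2 h3; apply: le_trans (h _ _ h1 h2 h3) _.
rewrite -mulrA ler_wpM2l //; apply: powR_weaken => //.
by rewrite (control_ge0 hw) // (control_mono hw).
Qed.

Lemma order_bound_control w w' a f : control S T w -> control S T w' ->
  (forall s t, S <= s -> s <= t -> t <= T -> w s t <= w' s t) ->
  0 <= a -> order_bound w a f -> order_bound w' a f.
Proof.
move=> hw hw' ww a0 [C C0 h]; exists C => // s t h1 h2 h3.
apply: le_trans (h _ _ h1 h2 h3) _; rewrite ler_wpM2l //.
apply: ge0_ler_powR; rewrite ?nnegrE ?ww //.
  exact: (control_ge0 hw).
exact: (control_ge0 hw').
Qed.

(** Finitely many constants have a common upper bound. *)
Lemma uniform_constant (P : nat -> R -> Prop) k :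
  (forall i C C', C <= C' -> P i C -> P i C') ->
  (forall i, (0 < i <= k)%N -> exists2 C, 0 <= C & P i C) ->
  exists2 C, 0 <= C & forall i, (0 < i <= k)%N -> P i C.
Proof.
move=> monoP; elim: k => [|k IH] h.
  by exists 0 => // i; rewrite lt0n leqn0; case: eqP.
have [|C C0 hC] := IH; first by move=> i /andP[i0 ik]; apply: h; rewrite i0 ltnW.
have [|D D0 hD] := h k.+1; first by rewrite leqnn.
exists (C + D); first exact: addr_ge0.
move=> i /andP[i0]; rewrite leq_eqVlt => /orP[/eqP ->|ik].
  by apply: monoP hD; rewrite lerDr.
by apply: monoP (hC i _); rewrite ?lerDl // i0.
Qed.

Lemma order_bound_uniform w a (f : nat -> R -> R -> R) k :
  (forall i, (0 < i <= k)%N -> order_bound w a (f i)) ->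
  exists2 C, 0 <= C & forall i, (0 < i <= k)%N ->
    forall s t, S <= s -> s <= t -> t <= T -> f i s t <= C * w s t `^ a.
Proof.
apply: uniform_constant => i C C' CC h s t h1 h2 h3.
by apply: le_trans (h s t h1 h2 h3) _; rewrite ler_wpM2r ?powR_ge0.
Qed.

(** Two controls and two exponents reduce to their sum and minimum. *)
Lemma additive_order_bound_eq0 (E : completeNormedModType R) (D : R -> R -> E)
    w1 a1 f1 w2 a2 f2 :
  control S T w1 -> control S T w2 -> 1 < a1 -> 1 < a2 ->
  order_bound w1 a1 f1 -> order_bound w2 a2 f2 ->
  (forall s u t, S <= s -> s <= u -> u <= t -> t <= T ->
    D s t = D s u + D u t) ->
  (forall s t, S <= s -> s <= t -> t <= T -> `|D s t| <= f1 s t + f2 s t) ->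
  forall s t, S <= s -> s <= t -> t <= T -> D s t = 0.
Proof.
move=> hw1 hw2 a11 a21 b1 b2 addD leD.
have hw := controlD hw1 hw2; set w := (fun s t => _) in hw.
pose a := Num.min a1 a2.
have a_gt1 : 1 < a by rewrite lt_min a11.
have a_gt0 : 0 < a by exact: lt_trans a_gt1.
have [C _ hC] : order_bound w a (fun s t => f1 s t + f2 s t).
  apply: order_boundD.
    apply: (@order_bound_weaken _ a1) => //; first by rewrite ge_min lexx.
    apply: (order_bound_control hw1 hw) => //; last by rewrite ltW // (lt_trans ltr01).
    by move=> s t *; rewrite lerDl (control_ge0 hw2).
  apply: (@order_bound_weaken _ a2) => //; first by rewrite ge_min lexx orbT.
  apply: (order_bound_control hw2 hw) => //; last by rewrite ltW // (lt_trans ltr01).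
  by move=> s t *; rewrite lerDr (control_ge0 hw1).
apply: (additive_small_eq0 hw a_gt1 (C := C)) => // s t h1 h2 h3.
exact: le_trans (leD _ _ h1 h2 h3) (hC _ _ h1 h2 h3).
Qed.

End OrderBounds.

Section Multiplicative.
Context {R : realType} {V : completeNormedModType R} {A : tensor_algebra V}.
Variables (S T : R).
Local Notation lvln i X := (fun s t => `|lvl (X s t) i|).

Definition unital k (X : two_param A k) : Prop :=
  forall s t, S <= s -> s <= t -> t <= T -> lvl (X s t) 0 = (1 : R^o).

Definition chen_at k (X : two_param A k) i : Prop :=
  forall s u t, S <= s -> s <= u -> u <= t -> t <= T ->
    lvl (X s t) i = lvl (X s u) i + lvl (X u t) i +
      chen_defect i (lvl (X s u)) (lvl (X u t)).

Lemma multiplicative_unital k (X : two_param A k) :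
  multiplicative_functional S T X -> unital X.
Proof. by case=> _ h _ s t *; apply: h; split. Qed.

Lemma multiplicative_chen k (X : two_param A k) i :
  multiplicative_functional S T X -> (0 < i <= k)%N -> chen_at X i.
Proof.
move=> mX /andP[i0 ik] s u t h1 h2 h3 h4.
have uX := multiplicative_unital mX; case: mX => _ _ mX.
rewrite -(mX s u t) // lvl_mul // convolE ?uX //.
  exact: le_trans h4.
exact: le_trans h2.
Qed.

Lemma chen_multiplicative k (X : two_param A k) : unital X ->
  (forall i, (0 < i <= k)%N -> chen_at X i) ->
  forall s u t, S <= s -> s <= u -> u <= t -> t <= T ->
    ttens_mul (X s u) (X u t) = X s t.
Proof.
move=> uX cX s u t h1 h2 h3 h4; apply: ttens_ext => i ik; rewrite lvl_mul //.
have u1 : lvl (X s u) 0 = (1 : R^o) by apply: uX => //; exact: le_trans h4.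
have u2 : lvl (X u t) 0 = (1 : R^o) by apply: uX => //; exact: le_trans h2.
case: i ik => [_|i ik].
  by rewrite convol0 // uX // (le_trans h2).
by rewrite convolE // -cX.
Qed.

Lemma chen_defect_bound w phi k (X Y : two_param A k) i :
  control S T w -> 0 < phi ->
  (forall j, (0 < j < i)%N -> order_bound S T w phi (lvln j X)) ->
  (forall j, (0 < j < i)%N -> order_bound S T w phi (lvln j Y)) ->
  exists2 C, 0 <= C & forall s u t, S <= s -> s <= u -> u <= t -> t <= T ->
    `|chen_defect i (lvl (X s u)) (lvl (Y u t))| <=
      C * (w s u `^ phi * w u t `^ phi).
Proof.
case: i => [|i] hw phi0 bX bY.
  exists 0 => // s u t *.
  by rewrite /chen_defect big_geq // normr0 mul0r.
have [|C C0 hC] := @order_bound_uniform _ S T w phi (fun j => lvln j X) i.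
  by move=> j ji; exact: bX.
have [|D D0 hD] := @order_bound_uniform _ S T w phi (fun j => lvln j Y) i.
  by move=> j ji; exact: bY.
exists (\sum_(1 <= j < i.+1) C * D).
  by apply: sumr_ge0 => j _; rewrite mulr_ge0.
move=> s u t h1 h2 h3 h4.
apply: le_trans (norm_chen_defect _ _ _) _.
rewrite mulr_suml !big_nat; apply: ler_sum => j /andP[j0 ji].
have ijr : (0 < i.+1 - j <= i)%N.
  by rewrite subn_gt0 ji -ltnS ltn_subrL j0.
rewrite mulrACA; apply: ler_pM => //.
- by apply: (hC j); rewrite ?j0 //; exact: le_trans h4.
- by apply: (hD (i.+1 - j)%N) => //; exact: le_trans h2.
Qed.

Lemma pvar_order_bound p w K k (X : two_param A k) i :
  control S T w -> pvar_controlled S T p w K X -> (0 < i <= k)%N ->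
  order_bound S T w (i%:R / p) (lvln i X).
Proof.
move=> hw pX ik; exists (`|K / (beta_cst p * rfact (i%:R / p))|) => // s t h1 h2 h3.
apply: le_trans (pX i ik s t _) _; first by split.
by rewrite mulrAC ler_wpM2r ?powR_ge0 // ler_norm.
Qed.

(** These constants occur as denominators in the definition of finite
    [p]-variation, whose bounds are thus plain orders of magnitude. *)
Lemma pvar_cst_gt0 (p : R) i : 0 < p -> (0 < i)%N ->
  0 < beta_cst p * rfact (i%:R / p).
Proof.
move=> p0 i0; rewrite mulr_gt0 ?beta_cst_gt0 // /rfact Gamma_gt0 //.
by rewrite ltrDr divr_gt0 ?ltr0n.
Qed.

Lemma pvar_controlledW p w K K' k (X : two_param A k) : 0 < p -> K <= K' ->
  pvar_controlled S T p w K X -> pvar_controlled S T p w K' X.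
Proof.
move=> p0 KK h i ik s t st; apply: le_trans (h i ik s t st) _.
have [i0 _] := andP ik.
by rewrite ler_pM2r ?invr_gt0 ?pvar_cst_gt0 // ler_wpM2r ?powR_ge0.
Qed.

Lemma order_bound_pvar p w k (X : two_param A k) : 0 < p ->
  (forall i, (0 < i <= k)%N -> order_bound S T w (i%:R / p) (lvln i X)) ->
  exists2 K, 0 <= K & pvar_controlled S T p w K X.
Proof.
move=> p0 bX.
have [||K K0 hK] := @uniform_constant _ (fun i K => (0 < i)%N -> forall s t,
  simplex S T (s, t) -> `|lvl (X s t) i| <=
    K * w s t `^ (i%:R / p) / (beta_cst p * rfact (i%:R / p))) k.
- move=> i C C' CC h i0 s t st; apply: le_trans (h i0 s t st) _.
  by rewrite ler_pM2r ?invr_gt0 ?pvar_cst_gt0 // ler_wpM2r ?powR_ge0.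
- move=> i ik; have [i0 _] := andP ik; have [C C0 hC] := bX i ik.
  have c0 := pvar_cst_gt0 p0 i0; set c := _ * _ in c0 *.
  exists (C * c); first by rewrite mulr_ge0 // ltW.
  move=> _ s t [h1 h2 h3].
  by rewrite mulrAC mulfK ?gt_eqF //; exact: hC.
by exists K => // i ik; apply: hK => //; case/andP: ik.
Qed.

End Multiplicative.

(** * Continuity of multiplicative functionals *)

Lemma prod_topology_cvg (J Z : Type) (U : J -> topologicalType) (F : set_system Z)
    (g : Z -> prod_topology U) (l : prod_topology U) : Filter F ->
  (forall i, g z i @[z --> F] --> l i) -> g @ F --> l.
Proof.
move=> FF gl; apply/cvg_sup => i P.
rewrite nbhsE => -[B [[C oC CB] Bl] BP].
rewrite nbhs_filterE; have := gl i C.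
have Cl : nbhs (l i) C.
  by rewrite nbhsE; exists C => //; split => //; move: Bl; rewrite -CB.
move=> /(_ Cl) H; apply: (@filterS _ F _ (fun z => C (g z i))) => // z Cz.
by apply: BP; rewrite -CB.
Qed.

Section Continuity.
Context {R : realType} {V : completeNormedModType R} {A : tensor_algebra V}.
Variables (S T : R) (w : R -> R -> R) (hw : control S T w).
Local Notation lvln i X := (fun s t => `|lvl (X s t) i|).

Lemma control_small (phi t e : R) : 0 < phi -> S <= t -> t <= T -> 0 < e ->
  exists2 d, 0 < d & forall a b, S <= a -> a <= b -> b <= T ->
    `|t - a| < d -> `|t - b| < d -> w a b `^ phi < e.
Proof.
move=> phi0 h1 h2 e0.
have e'0 : 0 < e `^ phi^-1 by rewrite powR_gt0.
have /nbhs_ballP[d /= d0 hd] := control_near_diag hw h1 h2 e'0.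
exists d => // a b Sa ab bT ta tb.
have H : w a b < e `^ phi^-1 by apply: (hd (a, b)); split.
have w0 : 0 <= w a b by exact: (control_ge0 hw).
have : w a b `^ phi < (e `^ phi^-1) `^ phi.
  by apply: gt0_ltr_powR; rewrite ?nnegrE ?powR_ge0.
by rewrite -powRrM mulVf ?gt_eqF // powRr1 // ltW.
Qed.

Variables (phi : R) (phi0 : 0 < phi) (k : nat) (X : two_param A k).
Hypothesis chenX : forall i, (0 < i <= k)%N -> chen_at S T X i.
Hypothesis boundX : forall i, (0 < i <= k)%N -> order_bound S T w phi (lvln i X).

(** Chen's relation turns the increment in one variable into the value on the
    increment times bounded terms. *)
Let level_modulus i : (0 < i <= k)%N -> exists2 C, 0 <= C &
  forall s u t, S <= s -> s <= u -> u <= t -> t <= T ->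
    `|lvl (X s t) i - lvl (X s u) i| <= C * w u t `^ phi /\
    `|lvl (X s t) i - lvl (X u t) i| <= C * w s u `^ phi.
Proof.
move=> ik; have [i0 ik'] := andP ik.
have bX j : (0 < j < i)%N -> order_bound S T w phi (lvln j X).
  by move=> /andP[j0 ji]; apply: boundX; rewrite j0 ltnW // (leq_trans ji).
have [C C0 hC] := chen_defect_bound hw phi0 bX bX.
have [D D0 hD] := boundX ik.
exists (C * w S T `^ phi + D); first by rewrite addr_ge0 ?mulr_ge0 ?powR_ge0.
move=> s u t h1 h2 h3 h4; have Su := le_trans h1 h2; have uT := le_trans h3 h4.
have := hC s u t h1 h2 h3 h4; have := hD _ _ h1 h2 uT.
have := hD _ _ Su h3 h4; rewrite (chenX ik h1 h2 h3 h4).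
set x := lvl (X s u) i; set y := lvl (X u t) i; set z := chen_defect _ _ _.
have p1 := powR_ge0 (w s u) phi; have p2 := powR_ge0 (w u t) phi.
have q1 : w s u `^ phi <= w S T `^ phi.
  by apply: (control_powR_mono hw) => //; exact: ltW.
have q2 : w u t `^ phi <= w S T `^ phi.
  by apply: (control_powR_mono hw) => //; exact: ltW.
move=> hy hx hz; split.
  have -> : x + y + z - x = y + z by zmod_eq.
  apply: le_trans (ler_normD _ _) _.
  have : C * (w s u `^ phi * w u t `^ phi) <= C * (w S T `^ phi * w u t `^ phi).
    by rewrite ler_wpM2l // ler_wpM2r.
  by move: hy hz; lra.
have -> : x + y + z - y = x + z by zmod_eq.
apply: le_trans (ler_normD _ _) _.
have : C * (w s u `^ phi * w u t `^ phi) <= C * (w s u `^ phi * w S T `^ phi).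
  by rewrite ler_wpM2l // ler_wpM2l.
by move: hx hz; lra.
Qed.

(** Both variables are moved one at a time through the minimum of [s] and [s'],
    which keeps the intermediate pairs in the simplex. *)
Let level_dist i : (0 < i <= k)%N -> exists2 C, 0 <= C &
  forall s t s' t', S <= s -> s <= t -> t <= T -> S <= s' -> s' <= t' -> t' <= T ->
    `|lvl (X s t) i - lvl (X s' t') i| <=
      C * (w (Num.min s s') (Num.max s s') `^ phi +
           w (Num.min t t') (Num.max t t') `^ phi).
Proof.
move=> ik; have [C C0 hC] := level_modulus ik.
exists (2 * C) => [|s t s' t' h1 h2 h3 h1' h2' h3']; first by rewrite mulr_ge0.
set m := Num.min s s'; set M := Num.max s s'.
set n := Num.min t t'; set N := Num.max t t'.
have Sm : S <= m by rewrite le_min h1.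
have ms : m <= s by rewrite ge_min lexx.
have ms' : m <= s' by rewrite ge_min lexx orbT.
have sM : s <= M by rewrite le_max lexx.
have s'M : s' <= M by rewrite le_max lexx orbT.
have MT : M <= T by rewrite ge_max (le_trans h2) // (le_trans h2').
have NT : N <= T by rewrite ge_max h3.
have mn : m <= n by rewrite le_min (le_trans ms) // (le_trans ms').
have nN : n <= N by rewrite ge_min le_max lexx.
have [_ d1] := hC m s t Sm ms h2 h3.
have [_ d2] := hC m s' t' Sm ms' h2' h3'.
have d3 : `|lvl (X m t) i - lvl (X m t') i| <= C * w n N `^ phi.
  have [tt'|tt'] := leP t t'.
    have [d _] := hC m t t' Sm (le_trans ms h2) tt' h3'.
    rewrite distrC; move: d; rewrite /n /N min_l ?max_r //.
  have [d _] := hC m t' t Sm (le_trans ms' h2') (ltW tt') h3.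
  by move: d; rewrite /n /N min_r ?max_l // ltW.
have m1 : w m s `^ phi <= w m M `^ phi.
  by apply: (control_powR_mono hw) => //; exact: ltW.
have m2 : w m s' `^ phi <= w m M `^ phi.
  by apply: (control_powR_mono hw) => //; exact: ltW.
have := ler_wpM2l C0 m1; have := ler_wpM2l C0 m2.
have -> : lvl (X s t) i - lvl (X s' t') i =
    (lvl (X m t) i - lvl (X m t') i) - (lvl (X m t) i - lvl (X s t) i) +
    (lvl (X m t') i - lvl (X s' t') i) by zmod_eq.
move=> e1 e2; apply: le_trans (ler_normD _ _) _.
apply: le_trans (lerD (ler_normB _ _) (lexx _)) _.
have := mulr_ge0 C0 (powR_ge0 (w n N) phi).
move: d1 d2 d3; lra.
Qed.

Let ttens_lvlE (a : ttens A k) (i : 'I_k.+1) : a i = lvl a i.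
Proof.
case: i => i lt_ik; rewrite /lvl; case: {-}_ / idP => //= lt_ik'.
by rewrite (bool_irrelevance lt_ik lt_ik').
Qed.

(** The continuity required of a multiplicative functional is automatic: the
    control is continuous and vanishes on the diagonal. *)
Lemma multiplicative_of_bounds : unital S T X -> multiplicative_functional S T X.
Proof.
move=> uX; split.
- apply/subspace_continuousP => -[s t] [/= h1 h2 h3].
  apply: prod_topology_cvg => -[[|i] lt_ik]; apply/cvgrPdist_lt => e e0;
    rewrite near_withinE.
    apply: nearW => -[s' t'] [/= h1' h2' h3']; rewrite !ttens_lvlE /= !uX //.
    by rewrite subrr normr0.
  have ik : (0 < i.+1 <= k)%N by [].
  have [C C0 hC] := level_dist ik.
  have c0 : 0 < 2 * C + 1 by rewrite ltr_wpDl ?mulr_ge0.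
  have e'0 : 0 < e / (2 * C + 1) by rewrite divr_gt0.
  have [d1 d10 hd1] := control_small phi0 h1 (le_trans h2 h3) e'0.
  have [d2 d20 hd2] := control_small phi0 (le_trans h1 h2) h3 e'0.
  apply/nbhs_ballP; exists (Num.min d1 d2); first by rewrite /= lt_min d10.
  move=> [s' t'] [/= sd td] [/= h1' h2' h3']; rewrite !ttens_lvlE /=.
  move: sd td; rewrite /ball /= !lt_min => /andP[ss' _] /andP[_ tt'].
  apply: le_lt_trans (hC _ _ _ _ h1 h2 h3 h1' h2' h3') _.
  have near_minmax (a b d : R) : 0 < d -> `|a - b| < d ->
      `|a - Num.min a b| < d /\ `|a - Num.max a b| < d.
    by move=> d0 ab; case: (leP a b) => _; rewrite subrr normr0.
  have [a1 a2] := near_minmax _ _ _ d10 ss'.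
  have [b1 b2] := near_minmax _ _ _ d20 tt'.
  have min_max (a b : R) : Num.min a b <= Num.max a b by rewrite ge_min le_max lexx.
  have sT := le_trans h2 h3; have s'T := le_trans h2' h3'.
  have St := le_trans h1 h2; have St' := le_trans h1' h2'.
  have := hd1 _ _ _ (min_max s s') _ a1 a2.
  rewrite le_min h1 h1' ge_max sT s'T => /(_ isT isT).
  have := hd2 _ _ _ (min_max t t') _ b1 b2.
  rewrite le_min St St' ge_max h3 h3' => /(_ isT isT).
  set x := _ `^ phi; set y := _ `^ phi => hx hy.
  have -> : e = (2 * C + 1) * (e / (2 * C + 1)) by rewrite mulrC divfK ?gt_eqF.
  move: hx hy e'0; set z := e / _ => hx hy z0.
  have : C * (y + x) <= C * (z + z) by rewrite ler_wpM2l // lerD // ltW.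
  by move: z0; lra.
- by move=> s t [h1 h2 h3]; exact: uX.
- exact: chen_multiplicative.
Qed.

End Continuity.

(** * Extension by one level *)

Section Extension.
Context {R : realType} {V : completeNormedModType R} {A : tensor_algebra V}.
Variables (S T : R).
Local Notation lvln i X := (fun s t => `|lvl (X s t) i|).

Definition eq_level k k' (X : two_param A k) (Y : two_param A k') i : Prop :=
  forall s t, S <= s -> s <= t -> t <= T -> lvl (X s t) i = lvl (Y s t) i.

Lemma chen_defect_eq_level k k' (X : two_param A k) (Y : two_param A k') i :
  (forall j, (0 < j < i)%N -> eq_level X Y j) ->
  forall s u t, S <= s -> s <= u -> u <= t -> t <= T ->
    chen_defect i (lvl (X s u)) (lvl (X u t)) =
    chen_defect i (lvl (Y s u)) (lvl (Y u t)).
Proof.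
move=> e s u t h1 h2 h3 h4; apply: eq_chen_defect => j ji; apply: e => //.
  exact: le_trans h4.
exact: le_trans h2.
Qed.

(** If the lower levels agree, then so do the defects, hence the difference at
    level [i] is additive; being smaller than linear in a control, it is
    zero. *)
Lemma chen_level_unique k k' (Y : two_param A k) (Y' : two_param A k') i
    w1 a1 f1 w2 a2 f2 :
  control S T w1 -> control S T w2 -> 1 < a1 -> 1 < a2 ->
  order_bound S T w1 a1 f1 -> order_bound S T w2 a2 f2 ->
  chen_at S T Y i -> chen_at S T Y' i ->
  (forall j, (0 < j < i)%N -> eq_level Y Y' j) ->
  (forall s t, S <= s -> s <= t -> t <= T ->
    `|lvl (Y s t) i - lvl (Y' s t) i| <= f1 s t + f2 s t) ->
  eq_level Y Y' i.
Proof.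
move=> hw1 hw2 a11 a21 b1 b2 cY cY' e bd s t h1 h2 h3.
apply/eqP; rewrite -subr_eq0; apply/eqP.
apply: (additive_order_bound_eq0 (D := fun s t => lvl (Y s t) i - lvl (Y' s t) i)
  hw1 hw2 a11 a21 b1 b2) => // {h1 h2 h3}s u {}t h1 h2 h3 h4.
rewrite (cY _ _ _ h1 h2 h3 h4) (cY' _ _ _ h1 h2 h3 h4).
by rewrite (chen_defect_eq_level e h1 h2 h3 h4); zmod_eq.
Qed.

Lemma is_ext_unique m (Z : two_param A m) (Y Y' : two_param A m.+1) :
  is_ext S T Z Y -> is_ext S T Z Y' ->
  forall i, (i <= m.+1)%N -> eq_level Y Y' i.
Proof.
move=> [q [/andP[q1 qm] _ [w [hw [mY [K vY]]]] eY]].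
move=> [q' [/andP[q1' qm'] _ [w' [hw' [mY' [K' vY']]]] eY']].
have e i : (i <= m)%N -> eq_level Y Y' i.
  move=> im s t h1 h2 h3; have st : simplex S T (s, t) by [].
  by rewrite eY // eY'.
move=> i; rewrite leq_eqVlt => /orP[/eqP ->|]; last by rewrite ltnS; exact: e.
have im : (0 < m.+1 <= m.+1)%N by rewrite /=.
apply: (chen_level_unique hw hw' _ _ (pvar_order_bound hw vY im)
  (pvar_order_bound hw' vY' im)).
- by rewrite ltr_pdivlMr ?mul1r // (lt_le_trans ltr01).
- by rewrite ltr_pdivlMr ?mul1r // (lt_le_trans ltr01).
- exact: multiplicative_chen.
- exact: multiplicative_chen.
- by move=> j /andP[_ jm]; exact: e.
- by move=> s t h1 h2 h3; exact: ler_normB.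
Qed.

Variables (w : R -> R -> R) (hw : control S T w) (phi : R).

(** The top level [y] has to solve [y s t - y s u - y u t = g s u t], where [g] is
    the defect computed from [Z]. The cocycle identity at [S, s, u, t] shows that
    [F s t = - g S s t] is a solution, though not a small one; since its defect
    [g] is of order [2 * phi > 1], subtracting the additive map sewn from [F]
    makes it small. *)
Lemma lyons_extension m (Z : two_param A m) : 1 < 2 * phi -> unital S T Z ->
  (forall i, (0 < i <= m)%N -> chen_at S T Z i) ->
  (forall i, (0 < i <= m)%N -> order_bound S T w phi (lvln i Z)) ->
  exists Y : two_param A m.+1,
    [/\ unital S T Y,
        forall i, (0 < i <= m.+1)%N -> chen_at S T Y i,
        forall i, (i <= m)%N -> eq_level Y Z i &
        order_bound S T w (2 * phi) (lvln m.+1 Y)].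
Proof.
move=> phi2 uZ cZ bZ; have phi0 : 0 < phi by lra.
pose g s u t := chen_defect m.+1 (lvl (Z s u)) (lvl (Z u t)).
have g_cocycle s u t v : S <= s -> s <= u -> u <= t -> t <= v -> v <= T ->
    g s t v + g s u t = g s u v + g u t v.
  move=> h1 h2 h3 h4 h5.
  have Su := le_trans h1 h2; have St := le_trans Su h3.
  have tT := le_trans h4 h5; have uT := le_trans h3 tT.
  have := chen_defect_cocycle (ltn0Sn m) (uZ _ _ h1 h2 uT) (uZ _ _ Su h3 tT)
    (uZ _ _ St h4 h5).
  have -> : chen_defect m.+1 (convol (lvl (Z s u)) (lvl (Z u t))) (lvl (Z t v)) =
      g s t v.
    apply: eq_chen_defect => // j /andP[j0 jm].
    by rewrite -(lvl_mul _ _ (jm : (j <= m)%N)) (chen_multiplicative uZ cZ).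
  have -> : chen_defect m.+1 (lvl (Z s u)) (convol (lvl (Z u t)) (lvl (Z t v))) =
      g s u v.
    apply: eq_chen_defect => // j /andP[j0 jm].
    by rewrite -(lvl_mul _ _ (jm : (j <= m)%N)) (chen_multiplicative uZ cZ).
  by [].
have bZ' j : (0 < j < m.+1)%N -> order_bound S T w phi (lvln j Z) by exact: bZ.
have [C C0 hC] := chen_defect_bound hw phi0 bZ' bZ'.
pose F s t : tpow A m.+1 := - g S s t.
have defF s u t : S <= s -> s <= u -> u <= t -> t <= T ->
    F s t - F s u - F u t = g s u t.
  move=> h1 h2 h3 h4; have := g_cocycle _ _ _ _ (lexx S) h1 h2 h3 h4.
  rewrite /F => /(congr1 (fun x => x - g S s t)) E.
  by apply: (etrans _ (etrans E _)); zmod_eq.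
have bF s u t : S <= s -> s <= u -> u <= t -> t <= T ->
    `|F s t - F s u - F u t| <= C * w s t `^ (2 * phi).
  move=> h1 h2 h3 h4; rewrite defF //.
  apply: le_trans (hC _ _ _ h1 h2 h3 h4) _.
  by rewrite ler_wpM2l // (control_powR_mul hw).
have [B [addB [D D0 hD]]] := additive_sewing hw phi2 C0 bF.
pose Y : two_param A m.+1 := fun s t =>
  mk_ttens m.+1 (fun i => lvl (Z s t) i + tcast i (F s t - B s t)).
have Ylow i s t : (i <= m)%N -> lvl (Y s t) i = lvl (Z s t) i.
  move=> im; rewrite lvl_mk_ttens; last exact: leqW.
  by rewrite tcast_neq ?addr0 // gtn_eqF.
have Ytop s t : lvl (Y s t) m.+1 = F s t - B s t.
  by rewrite lvl_mk_ttens // lvl_gt // add0r tcast_id.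
exists Y; split.
- by move=> s t h1 h2 h3; rewrite Ylow // uZ.
- move=> i /andP[i0]; rewrite leq_eqVlt => /orP[/eqP ->|im] s u t h1 h2 h3 h4.
    have -> : chen_defect m.+1 (lvl (Y s u)) (lvl (Y u t)) = g s u t.
      by apply: eq_chen_defect => j /andP[_ jm]; rewrite Ylow.
    rewrite !Ytop -(defF _ _ _ h1 h2 h3 h4) (addB _ _ _ h1 h2 h3 h4).
    by zmod_eq.
  have im' : (0 < i <= m)%N by rewrite i0.
  rewrite !Ylow // (cZ i im' _ _ _ h1 h2 h3 h4); congr (_ + _).
  by apply: eq_chen_defect => j /andP[_ jm]; rewrite Ylow // ltnW // (leq_trans jm).
- by move=> i im s t *; exact: Ylow.
- by exists D => // s t h1 h2 h3; rewrite Ytop distrC hD.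
Qed.

(** The extension has finite [m / phi]-variation, with [m / phi < m + 1] by the
    lower bound on [phi]; uniqueness transfers the stronger bound of order
    [2 * phi] from the constructed extension to [Ext]. *)
Lemma Ext_spec m (Z : two_param A m) : (0 < m)%N ->
  m%:R / m.+1%:R < phi <= 1 -> unital S T Z ->
  (forall i, (0 < i <= m)%N -> chen_at S T Z i) ->
  (forall i, (0 < i <= m)%N -> order_bound S T w phi (lvln i Z)) ->
  [/\ unital S T (Ext S T Z),
      forall i, (0 < i <= m.+1)%N -> chen_at S T (Ext S T Z) i,
      forall i, (i <= m)%N -> eq_level (Ext S T Z) Z i &
      order_bound S T w (2 * phi) (lvln m.+1 (Ext S T Z))].
Proof.
move=> m0 /andP[phim phi1] uZ cZ bZ.
have m1 : (1 : R) <= m%:R by rewrite ler1n.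
have m'E : m.+1%:R = m%:R + 1 :> R by rewrite -natr1.
have m'0 : (0 : R) < m%:R + 1 by lra.
have phim' : m%:R < phi * (m%:R + 1).
  by rewrite -ltr_pdivrMr // -m'E.
have phi0 : 0 < phi by apply: le_lt_trans phim; rewrite divr_ge0.
have phi2 : 1 < 2 * phi by nra.
have [Y [uY cY eY bY]] := lyons_extension phi2 uZ cZ bZ.
have bY' i : (0 < i <= m.+1)%N -> order_bound S T w phi (lvln i Y).
  move=> /andP[i0]; rewrite leq_eqVlt => /orP[/eqP ->|im].
    by apply: order_bound_weaken bY => //; lra.
  apply: (order_bound_le _ (bZ i _)); last by rewrite i0.
  by move=> s t h1 h2 h3; rewrite eY.
have q0 : 0 < m%:R / phi by rewrite divr_gt0 // ltr0n.
have qE (i : nat) : i%:R / (m%:R / phi) = i%:R * phi / m%:R.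
  by rewrite invf_div mulrA.
have extY : is_ext S T Z Y.
  exists (m%:R / phi); split.
  - by rewrite ler_pdivlMr // ltr_pdivrMr // m'E mul1r (le_trans phi1) // mulrC.
  - exists w; split => //; split; first exact: (multiplicative_of_bounds hw phi0).
    have [|K _ vK] := @order_bound_pvar _ _ _ S T _ w _ Z q0; last by exists K.
    move=> i ik; have [i0 im] := andP ik; apply: order_bound_weaken (bZ i ik) => //.
      by rewrite divr_gt0 // ltr0n.
    rewrite qE ler_pdivrMr ?ltr0n // mulrC ler_wpM2l ?ler_nat //; exact: ltW.
  - exists w; split => //; split; first exact: (multiplicative_of_bounds hw phi0).
    have [|K _ vK] := @order_bound_pvar _ _ _ S T _ w _ Y q0; last by exists K.
    move=> i /andP[i0]; rewrite leq_eqVlt => /orP[/eqP ->|im].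
      apply: order_bound_weaken bY => //; first by rewrite divr_gt0 // ltr0n.
      rewrite qE ler_pdivrMr ?ltr0n // m'E; nra.
    apply: (@order_bound_weaken _ _ _ _ phi) => //.
    + by rewrite divr_gt0 // ltr0n.
    + by rewrite qE ler_pdivrMr ?ltr0n // mulrC ler_wpM2l ?ler_nat //; exact: ltW.
    + by apply: bY'; rewrite i0 ltnW.
  - by move=> i im s t [h1 h2 h3]; exact: eY.
have extE : is_ext S T Z (Ext S T Z).
  by apply: (xgetPex (zero_map m.+1)); exists Y.
have E := is_ext_unique extE extY.
split.
- by move=> s t h1 h2 h3; rewrite E // uY.
- by case: extE => q [_ _ [w' [_ [mE _]]] _] i im; exact: multiplicative_chen.
- by move=> i im s t h1 h2 h3; rewrite E ?eY // leqW.
- by apply: order_bound_le bY => s t h1 h2 h3; rewrite E.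
Qed.

End Extension.

(** * Induced functionals and the sewing of a levelwise sum *)

Section Induced.
Context {R : realType} {V : completeNormedModType R} {A : tensor_algebra V}.
Variables (S T : R).
Local Notation lvln i X := (fun s t => `|lvl (X s t) i|).
Local Notation lvlnB i X Y := (fun s t => `|lvl (X s t) i - lvl (Y s t) i|).

Definition additive_at k (I : two_param A k) i : Prop :=
  forall s u t, S <= s -> s <= u -> u <= t -> t <= T ->
    lvl (I s t) i = lvl (I s u) i + lvl (I u t) i.

Variables (w : R -> R -> R) (hw : control S T w) (phi theta : R).
Hypotheses (phi0 : 0 < phi) (phi1 : phi <= 1) (phi_theta : phi <= theta).

Lemma order_bound_close k k' (X : two_param A k) (Y : two_param A k') i :
  order_bound S T w theta (lvlnB i X Y) -> order_bound S T w phi (lvln i Y) ->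
  order_bound S T w phi (lvln i X).
Proof.
move=> bXY bY.
apply: order_bound_le (order_boundD (order_bound_weaken hw phi0 phi_theta bXY) bY).
by move=> s t *; rewrite -{1}(subrK (lvl (Y s t) i) (lvl (X s t) i)) ler_normD.
Qed.

(** The part of each level that the extension adds to [I] is of order [theta]:
    it vanishes at level one, and is of order [2 * phi] above. *)
Lemma ind_upto_spec k (I : two_param A k) m :
  (forall i, (0 < i <= m.+1)%N -> additive_at I i) ->
  (forall i, (0 < i <= m.+1)%N -> order_bound S T w phi (lvln i I)) ->
  m%:R / m.+1%:R < phi -> ((0 < m)%N -> theta <= 2 * phi) -> 0 < theta ->
  [/\ unital S T (ind_upto S T I m.+1),
      forall i, (0 < i <= m.+1)%N -> chen_at S T (ind_upto S T I m.+1) i &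
      forall i, (0 < i <= m.+1)%N ->
        order_bound S T w theta (lvlnB i (ind_upto S T I m.+1) I)].
Proof.
elim: m => [|m IH] addI bI mphi th2 th0.
  have lvl1 s t : lvl (ind_upto S T I 1 s t) 1 = lvl (I s t) 1.
    by rewrite /= lvl_mk_ttens.
  split.
  - by move=> s t *; rewrite /= lvl_mk_ttens.
  - case=> [|[|i]] // _ s u t h1 h2 h3 h4.
    rewrite !lvl1 /chen_defect big_geq // addr0; exact: addI.
  - case=> [|[|i]] // _; apply: order_bound0 => s t *.
    by rewrite lvl1 subrr normr0.
have mphi' : m%:R / m.+1%:R < phi.
  apply: le_lt_trans mphi; rewrite ler_pdivrMr ?ltr0n // mulrAC.
  rewrite ler_pdivlMr ?ltr0n // -!natrM ler_nat.
  by rewrite mulnS mulSn leq_add2r.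
have up i : (0 < i <= m.+1)%N -> (0 < i <= m.+2)%N.
  by move=> /andP[-> /leqW].
have [uZ cZ bZ] := IH (fun i im => addI i (up i im))
  (fun i im => bI i (up i im)) mphi' (fun=> th2 isT) th0.
set Z := ind_upto S T I m.+1 in uZ cZ bZ.
have bZ' i : (0 < i <= m.+1)%N -> order_bound S T w phi (lvln i Z).
  by move=> im; apply: order_bound_close (bZ i im) (bI i (up i im)).
have mphi1 : m.+1%:R / m.+2%:R < phi <= 1 by rewrite mphi.
have [uE cE eE bE] := Ext_spec hw (ltn0Sn m) mphi1 uZ cZ bZ'.
set X := ind_upto S T I m.+2.
have XE s t : X s t = ttens_add (Ext S T Z s t) (top_lvl (lvl (I s t) m.+2)) by [].
have Xlow i s t : (i <= m.+1)%N -> lvl (X s t) i = lvl (Ext S T Z s t) i.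
  by move=> im; rewrite XE lvl_add lvl_top tcast_neq ?addr0 // gtn_eqF.
have Xtop s t : lvl (X s t) m.+2 = lvl (Ext S T Z s t) m.+2 + lvl (I s t) m.+2.
  by rewrite XE lvl_add lvl_top tcast_id.
have mm : (0 < m.+2 <= m.+2)%N by rewrite /=.
split.
- by move=> s t h1 h2 h3; rewrite Xlow // uE.
- move=> i /andP[i0]; rewrite leq_eqVlt => /orP[/eqP ->|im] s u t h1 h2 h3 h4.
    rewrite !Xtop (cE _ mm _ _ _ h1 h2 h3 h4) (addI _ mm _ _ _ h1 h2 h3 h4).
    rewrite (_ : chen_defect _ (lvl (X s u)) (lvl (X u t)) =
      chen_defect m.+2 (lvl (Ext S T Z s u)) (lvl (Ext S T Z u t))).
      by zmod_eq.
    by apply: eq_chen_defect => j /andP[_ jm]; rewrite Xlow.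
  have im' : (0 < i <= m.+2)%N by rewrite i0 ltnW.
  rewrite !Xlow // (cE _ im' _ _ _ h1 h2 h3 h4); congr (_ + _).
  by apply: eq_chen_defect => j /andP[_ jm]; rewrite Xlow // ltnW // (leq_trans jm).
- move=> i /andP[i0]; rewrite leq_eqVlt => /orP[/eqP ->|im].
    apply: (order_bound_le _ (order_bound_weaken hw th0 (th2 isT) bE)).
    by move=> s t *; rewrite Xtop addrK.
  apply: (order_bound_le _ (bZ i _)); last by rewrite i0.
  by move=> s t h1 h2 h3; rewrite Xlow // eE.
Qed.

End Induced.

Section Sum.
Context {R : realType} {V : completeNormedModType R} {A : tensor_algebra V}.
Variables (S T : R).
Local Notation lvln i X := (fun s t => `|lvl (X s t) i|).
Local Notation lvlnB i X Y := (fun s t => `|lvl (X s t) i - lvl (Y s t) i|).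

Lemma sewing_unique k (X Y Y' : two_param A k) :
  is_sewing S T X Y -> is_sewing S T X Y' ->
  forall i, (i <= k)%N -> eq_level S T Y Y' i.
Proof.
move=> [p [th [w [[p1 th1 hw _] [[w0 [_ [mY _]]] [C hC]]]]]].
move=> [p' [th' [w' [[p1' th1' hw' _] [[w0' [_ [mY' _]]] [C' hC']]]]]].
move=> i; have [n] := ubnP i; elim: n i => // n IH i; rewrite ltnS => ni ik.
have [->|i0] := posnP i.
  by move=> s t h1 h2 h3; rewrite !(multiplicative_unital (S := S) (T := T)).
have ik' : (0 < i <= k)%N by rewrite i0.
have b1 : order_bound S T w th (lvlnB i Y X).
  exists `|C| => // s t h1 h2 h3; apply: le_trans (hC i ik' s t _) _ => //.
  by rewrite ler_wpM2r ?powR_ge0 // ler_norm.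
have b2 : order_bound S T w' th' (lvlnB i Y' X).
  exists `|C'| => // s t h1 h2 h3; apply: le_trans (hC' i ik' s t _) _ => //.
  by rewrite ler_wpM2r ?powR_ge0 // ler_norm.
apply: (chen_level_unique hw hw' th1 th1' b1 b2).
- exact: multiplicative_chen.
- exact: multiplicative_chen.
- move=> j /andP[j0 ji]; apply: IH; first exact: leq_trans ji ni.
  exact: leq_trans (ltnW ji) ik.
- move=> s t h1 h2 h3.
  have -> : lvl (Y s t) i - lvl (Y' s t) i =
    (lvl (Y s t) i - lvl (X s t) i) - (lvl (Y' s t) i - lvl (X s t) i) by zmod_eq.
  exact: ler_normB.
Qed.

Lemma lvl_oplus k (X H : two_param A k) s t i : (0 < i <= k)%N ->
  lvl (oplus X H s t) i = lvl (X s t) i + lvl (H s t) i.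
Proof. by case: i => // i ik; rewrite lvl_mk_ttens. Qed.

Lemma lvl_oplus0 k (X H : two_param A k) s t :
  lvl (oplus X H s t) 0 = (1 : R^o).
Proof. by rewrite lvl_mk_ttens. Qed.

(** When [X] and [H] are of order [phi], all defects are of order [2 * phi]; so
    the levelwise sum is almost multiplicative, and the only multiplicative
    functional that differs from it by order [theta] is its sewing. At level
    one the defect is an empty sum, whence the restriction to [1 < k]. *)
Lemma is_sewing_oplus p phi theta w k (X H Y : two_param A k) :
  1 <= p -> 0 < phi -> 1 < theta -> ((1 < k)%N -> theta <= 2 * phi) ->
  control S T w ->
  unital S T X -> unital S T H ->
  (forall i, (0 < i <= k)%N -> chen_at S T X i) ->
  (forall i, (0 < i <= k)%N -> chen_at S T H i) ->
  (forall i, (0 < i <= k)%N -> order_bound S T w phi (lvln i X)) ->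
  (forall i, (0 < i <= k)%N -> order_bound S T w phi (lvln i H)) ->
  (forall i, (0 < i <= k)%N -> order_bound S T w (i%:R / p) (lvln i X)) ->
  (forall i, (0 < i <= k)%N -> order_bound S T w (i%:R / p) (lvln i H)) ->
  Omega S T k p Y ->
  (forall i, (0 < i <= k)%N ->
    order_bound S T w theta (lvlnB i Y (oplus X H))) ->
  is_sewing S T (oplus X H) Y.
Proof.
move=> p1 phi0 th1 th2 hw uX uH cX cH bX bH pX pH oY bY.
have p0 : 0 < p by exact: lt_le_trans p1.
have th0 : 0 < theta by exact: lt_trans th1.
exists p, theta, w; split; last first.
  split => //; have [C _ hC] := order_bound_uniform bY.
  by exists C => i ik s t [h1 h2 h3]; exact: hC.
split => //; split; first by move=> s t _; exact: lvl_oplus0.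
have bD i (P : two_param A k) (Q : two_param A k) : (0 < i <= k)%N ->
    (forall j, (0 < j <= k)%N -> order_bound S T w phi (lvln j P)) ->
    (forall j, (0 < j <= k)%N -> order_bound S T w phi (lvln j Q)) ->
    exists2 C, 0 <= C & forall s u t, S <= s -> s <= u -> u <= t -> t <= T ->
      `|chen_defect i (lvl (P s u)) (lvl (Q u t))| <= C * w s t `^ theta.
  move=> /andP[i0 ik] bP bQ; have [i1|i1] := leqP i 1.
    exists 0 => // s u t *.
    by rewrite /chen_defect big_geq // normr0 mul0r.
  have th2' := th2 (leq_trans i1 ik).
  have jk j : (0 < j < i)%N -> (0 < j <= k)%N.
    by move=> /andP[-> ji] /=; rewrite ltnW // (leq_trans ji).
  have [C C0 hC] := chen_defect_bound hw phi0 (fun j h => bP j (jk j h))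
    (fun j h => bQ j (jk j h)).
  have : order_bound S T w theta (fun s t => C * w s t `^ (2 * phi)).
    by apply: (order_bound_weaken hw th0 th2'); exists C.
  move=> [D D0 hD]; exists D => // s u t h1 h2 h3 h4.
  apply: le_trans (hD s t h1 (le_trans h2 h3) h4).
  apply: le_trans (hC s u t h1 h2 h3 h4) _.
  by rewrite ler_wpM2l // (control_powR_mul hw).
have bXH a i : (0 < i <= k)%N -> order_bound S T w a (lvln i X) ->
    order_bound S T w a (lvln i H) -> order_bound S T w a (lvln i (oplus X H)).
  move=> ik h h'; apply: order_bound_le (order_boundD h h') => s t *.
  by rewrite lvl_oplus // ler_normD.
have [K K0 vK] : exists2 K, 0 <= K & pvar_controlled S T p w K (oplus X H).
  by apply: order_bound_pvar => // i ik; apply: bXH; [|exact: pX|exact: pH].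
have [D D0 hD] : exists2 D, 0 <= D & forall i, (0 < i <= k)%N ->
    forall s u t, S <= s -> s <= u -> u <= t -> t <= T ->
      `|lvl (ttens_mul (oplus X H s u) (oplus X H u t)) i -
        lvl (oplus X H s t) i| <= D * w s t `^ theta.
  apply: uniform_constant.
    move=> i C C' CC h s u t h1 h2 h3 h4; apply: le_trans (h s u t h1 h2 h3 h4) _.
    by rewrite ler_wpM2r ?powR_ge0.
  move=> i ik; have [i0 ik'] := andP ik.
  have bO j (jk : (0 < j <= k)%N) := bXH phi j jk (bX j jk) (bH j jk).
  have [C1 C10 h1] := bD i _ _ ik bO bO.
  have [C2 C20 h2] := bD i _ _ ik bX bX.
  have [C3 C30 h3] := bD i _ _ ik bH bH.
  exists (C1 + C2 + C3); first by rewrite !addr_ge0.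
  move=> s u t e1 e2 e3 e4.
  rewrite lvl_mul // (convolE i0 (lvl_oplus0 _ _ _ _) (lvl_oplus0 _ _ _ _)).
  rewrite !lvl_oplus //.
  rewrite (cX i ik _ _ _ e1 e2 e3 e4) (cH i ik _ _ _ e1 e2 e3 e4).
  have := h1 _ _ _ e1 e2 e3 e4; have := h2 _ _ _ e1 e2 e3 e4.
  have := h3 _ _ _ e1 e2 e3 e4.
  set d1 := chen_defect i (lvl (oplus _ _ _ _)) _.
  set d2 := chen_defect i (lvl (X _ _)) _.
  set d3 := chen_defect i (lvl (H _ _)) _ => g3 g2 g1.
  rewrite (_ : _ - _ = d1 - d2 - d3); last by zmod_eq.
  apply: le_trans (ler_normB _ _) _; rewrite !mulrDl lerD //.
  by apply: le_trans (ler_normB _ _) _; rewrite lerD.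
exists (K + D); split; first exact: addr_ge0.
- by apply: pvar_controlledW vK => //; rewrite lerDl.
- move=> i ik s u t h1 h2 h3 h4; apply: le_trans (hD i ik s u t h1 h2 h3 h4) _.
  by rewrite ler_wpM2r ?powR_ge0 // lerDr.
Qed.

End Sum.

(** * The induced rough path *)

Section InducedRoughPath.
Context {R : realType} {V : completeNormedModType R} {A : tensor_algebra V}.
Variables (S T p phi theta : R) (w : R -> R -> R).
Hypotheses (hp : 1 <= p) (hphi : 1 - p^-1 < phi <= 1) (hw : control S T w).
Local Notation N := (Num.truncn p).
Hypotheses (theta1 : 1 < theta) (phi_theta : phi <= theta)
  (theta_phi : (1 < N)%N -> theta <= 2 * phi).
Local Notation lvln i X := (fun s t => `|lvl (X s t) i|).
Local Notation lvlnB i X Y := (fun s t => `|lvl (X s t) i - lvl (Y s t) i|).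

Let p0 : 0 < p. Proof. exact: lt_le_trans hp. Qed.

Let phi0 : 0 < phi.
Proof.
have /andP[h _] := hphi; apply: le_lt_trans h.
by rewrite subr_ge0 invf_le1.
Qed.

Let N_le : N%:R <= p. Proof. by rewrite truncn_le ltW. Qed.

Let N_gt0 : (0 < N)%N. Proof. by rewrite truncn_gt0. Qed.

(** Below the top level, order [phi] suffices for finite [p]-variation because
    [i / p <= 1 - 1 / p < phi] for [i < N]. At the top level [N], the part added to
    [I] is of order [theta > 1], and [I] itself is of order [N / p]. *)
Lemma ind_spec (I : two_param A N) :
  (forall i, (0 < i <= N)%N -> additive_at S T I i) ->
  (forall i, (0 < i <= N)%N -> order_bound S T w phi (lvln i I)) ->
  order_bound S T w (N%:R / p) (lvln N I) ->
  [/\ [/\ unital S T (ind S T p I),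
          forall i, (0 < i <= N)%N -> chen_at S T (ind S T p I) i &
          forall i, (0 < i <= N)%N ->
            order_bound S T w phi (lvln i (ind S T p I))],
      forall i, (0 < i <= N)%N ->
        order_bound S T w (i%:R / p) (lvln i (ind S T p I)),
      forall i, (0 < i <= N)%N ->
        order_bound S T w theta (lvlnB i (ind S T p I) I),
      rough_path S T p (ind S T p I) &
      Hspace S T p (ind S T p I)].
Proof.
move=> addI bI bN; have /andP[phi_gt phi_le] := hphi.
have th0 : 0 < theta by exact: lt_trans theta1.
have NE : N.-1.+1 = N by rewrite prednK.
have pV : p * p^-1 = 1 by rewrite divff ?gt_eqF.
have pV0 : 0 < p^-1 by rewrite invr_gt0.
have low (i : nat) : (i < N)%N -> i%:R / p < phi.
  move=> iN; apply: le_lt_trans phi_gt.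
  have : (i.+1%:R : R) <= p by apply: le_trans N_le; rewrite ler_nat.
  rewrite -natr1 => h.
  have := ler_wpM2r (ltW pV0) h; rewrite mulrDl mul1r pV; lra.
have [uX cX bX] : [/\ unital S T (ind S T p I),
      forall i, (0 < i <= N)%N -> chen_at S T (ind S T p I) i &
      forall i, (0 < i <= N)%N ->
        order_bound S T w theta (lvlnB i (ind S T p I) I)].
  have := @ind_upto_spec _ _ _ S T w hw phi theta phi0 phi_le phi_theta _ I N.-1.
  rewrite NE; apply => //.
  - have N0 : (0 : R) < N%:R by rewrite ltr0n.
    apply: le_lt_trans phi_gt.
    rewrite -subn1 natrB // mulrBl mul1r divff ?gt_eqF //.
    by rewrite lerB // lef_pV2.
  - by move=> n1; apply: theta_phi; rewrite -NE ltnS.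
have bX' i (iN : (0 < i <= N)%N) := order_bound_close hw phi0 phi_theta (bX i iN) (bI i iN).
have pX i : (0 < i <= N)%N -> order_bound S T w (i%:R / p) (lvln i (ind S T p I)).
  move=> iN; have [i0] := andP iN.
  have ip0 : 0 < i%:R / p by rewrite divr_gt0 ?ltr0n.
  rewrite leq_eqVlt => /orP[/eqP iE|iltN].
    have ip1 : i%:R / p <= theta.
      by apply: le_trans (ltW theta1); rewrite ler_pdivrMr // mul1r iE.
    have bI' : order_bound S T w (i%:R / p) (lvln i I) by rewrite iE.
    apply: order_bound_le (order_boundD (order_bound_weaken hw ip0 ip1 (bX i iN)) bI').
    by move=> s t *; apply: le_trans (ler_normD _ _); rewrite subrK.
  exact: order_bound_weaken (ltW (low i iltN)) (bX' i iN).
have rX : rough_path S T p (ind S T p I).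
  exists w; split => //; split; first exact: (multiplicative_of_bounds hw phi0).
  by have [K _ vK] := order_bound_pvar p0 pX; exists K.
split => //; split => //.
have [K K0 hK] := order_bound_uniform bX'.
by exists w, phi, K; split => // j jN s t [h1 h2 h3]; exact: hK.
Qed.

End InducedRoughPath.

Theorem theorem5p1 (R : realType) (V : completeNormedModType R)
    (A : tensor_algebra V) (S T : R) (hST : S <= T)
    (p phi : R) (hp : 1 <= p) (hphi : 1 - p^-1 < phi <= 1)
    (I I' : two_param A (Num.truncn p))
    (hI : Ispace S T p phi I) (hI' : Ispace S T p phi I') :
  forall s t : R, S <= s -> s <= t -> t <= T ->
    boxplus S T p (ind S T p I) (ind S T p I') s t = ind S T p (Iadd I I') s t.
Proof.
set N := Num.truncn p.
have p0 : 0 < p by exact: lt_le_trans hp.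
have /andP[phi_gt phi_le] := hphi.
have phi0 : 0 < phi by apply: le_lt_trans phi_gt; rewrite subr_ge0 invf_le1.
have N_gt0 : (0 < N)%N by rewrite truncn_gt0.
have phi_half : (1 < N)%N -> 1 < 2 * phi.
  move=> N2; have p2 : 2 <= p.
    by apply: (@le_trans _ _ N%:R); [rewrite ler_nat|rewrite truncn_le ltW].
  have : p^-1 <= 2^-1 by rewrite lef_pV2 // posrE.
  by move: phi_gt; lra.
(* At [N = 1] the induced functional is [(1, I)] itself: any exponent in excess
   of 1 serves, and [2 * phi] need not be one. *)
pose theta : R := if (1 < N)%N then 2 * phi else 2.
have th1 : 1 < theta by rewrite /theta; case: ifP => // _; lra.
have th_ge : phi <= theta by rewrite /theta; case: ifP => _; lra.
have th_le : (1 < N)%N -> theta <= 2 * phi by rewrite /theta => ->.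
have Np0 : 0 < N%:R / p by rewrite divr_gt0 ?ltr0n.
have Ispace_bounds (J : two_param A N) w w' : control S T w -> control S T w' ->
    (forall s t, S <= s -> s <= t -> t <= T -> w s t <= w' s t) ->
    forall K, 0 <= K ->
    (forall j, (1 <= j <= N)%N -> forall s t, simplex S T (s, t) ->
      `|lvl (J s t) j| <= K * w s t `^ phi) ->
    (forall s t, simplex S T (s, t) -> `|lvl (J s t) N| <= K * w s t `^ (N%:R / p)) ->
    (forall i, (0 < i <= N)%N -> order_bound S T w' phi (fun s t => `|lvl (J s t) i|))
    /\ order_bound S T w' (N%:R / p) (fun s t => `|lvl (J s t) N|).
  move=> hw hw' ww K K0 bJ bN; split.
    move=> i iN; apply: (order_bound_control hw hw' ww (ltW phi0)).
    by exists K => // s t h1 h2 h3; apply: bJ.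
  apply: (order_bound_control hw hw' ww (ltW Np0)).
  by exists K => // s t h1 h2 h3; apply: bN.
case: hI => _ addI [w1 [K1 [hw1 K10 b1 bN1]]].
case: hI' => _ addI' [w2 [K2 [hw2 K20 b2 bN2]]].
have hw := controlD hw1 hw2; set w := (fun s t => _) in hw.
have ww1 s t : S <= s -> s <= t -> t <= T -> w1 s t <= w s t.
  by move=> *; rewrite lerDl (control_ge0 hw2).
have ww2 s t : S <= s -> s <= t -> t <= T -> w2 s t <= w s t.
  by move=> *; rewrite lerDr (control_ge0 hw1).
have [{}b1 {}bN1] := Ispace_bounds I w1 w hw1 hw ww1 K1 K10 b1 bN1.
have [{}b2 {}bN2] := Ispace_bounds I' w2 w hw2 hw ww2 K2 K20 b2 bN2.
have adI i : additive_at S T I i.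
  by move=> s u t h1 h2 h3 h4; rewrite -(addI _ _ _ h1 h2 h3 h4) lvl_add.
have adI' i : additive_at S T I' i.
  by move=> s u t h1 h2 h3 h4; rewrite -(addI' _ _ _ h1 h2 h3 h4) lvl_add.
pose J := Iadd I I'.
have JE i s t : lvl (J s t) i = lvl (I s t) i + lvl (I' s t) i by exact: lvl_add.
have adJ i : additive_at S T J i.
  move=> s u t h1 h2 h3 h4.
  by rewrite !JE (adI i _ _ _ h1 h2 h3 h4) (adI' i _ _ _ h1 h2 h3 h4); zmod_eq.
have bJ a i : order_bound S T w a (fun s t => `|lvl (I s t) i|) ->
    order_bound S T w a (fun s t => `|lvl (I' s t) i|) ->
    order_bound S T w a (fun s t => `|lvl (J s t) i|).
  move=> h h'; apply: order_bound_le (order_boundD h h') => s t *.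
  by rewrite JE ler_normD.
have [[uX cX bX] pX dX rX _] :=
  ind_spec hp hphi hw th1 th_ge th_le (fun i _ => adI i) b1 bN1.
have [[uH cH bH] pH dH _ HH] :=
  ind_spec hp hphi hw th1 th_ge th_le (fun i _ => adI' i) b2 bN2.
have [_ _ dY rY _] := ind_spec hp hphi hw th1 th_ge th_le (fun i _ => adJ i)
  (fun i iN => bJ phi i (b1 i iN) (b2 i iN)) (bJ _ _ bN1 bN2).
set X := ind S T p I in uX cX bX pX dX rX *.
set H := ind S T p I' in uH cH bH pH dH HH *.
set Y := ind S T p J in dY rY *.
have sewY : is_sewing S T (oplus X H) Y.
  apply: (is_sewing_oplus hp phi0 th1 th_le hw uX uH cX cH bX bH pX pH rY).
  move=> i iN.
  apply: order_bound_le (order_boundD (dY i iN) (order_boundD (dX i iN) (dH i iN))).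
  move=> s t *; rewrite lvl_oplus //.
  have -> : lvl (Y s t) i - (lvl (X s t) i + lvl (H s t) i) =
      (lvl (Y s t) i - lvl (J s t) i) -
      ((lvl (X s t) i - lvl (I s t) i) + (lvl (H s t) i - lvl (I' s t) i)).
    by rewrite JE; zmod_eq.
  by apply: le_trans (ler_normB _ _) _; rewrite lerD // ler_normD.
have sewX : is_sewing S T (oplus X H) (sewing S T (oplus X H)).
  by apply: (xgetPex (zero_map N)); exists Y.
have -> : boxplus S T p X H = sewing S T (oplus X H).
  have : [set Z | [/\ rough_path S T p X, Hspace S T p H &
      Z = sewing S T (oplus X H)]] (boxplus S T p X H).
    by apply: (xgetPex (zero_map N)); exists (sewing S T (oplus X H)).
  by case.
move=> s t h1 h2 h3; apply: ttens_ext => i iN.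
exact: (sewing_unique sewX sewY).
Qed.
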